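(* Let $S$ be a countable graph and let $P$ be a transition kernel for a Markov process on $S$. Let $\eta=(S,\eta_0,P)$, with $\eta_0:S\to\mathbb{N}\cup\{0\}$, define an activated random walk (ARW) process with sleep rate $\lambda\in(0,\infty]$ and law $\mathbb{P}^{\eta}_{(\lambda)}$. Let $\gamma=(S,\gamma_0,P)$, with $\gamma_0:S\to\mathbb{N}\cup\{0\}$ and $\sum_{x\in S}\gamma_0(x)<\infty$, define a multiple source internal aggregation (MSIA) process with law $\mathcal{P}^{\gamma}$. Assume $\gamma_0\le\eta_0$, i.e. $\gamma_0(x)\le\eta_0(x)$ for all $x\in S$. Then for any integer $r$ and any $x\in S$, regardless of the value of $\lambda\in(0,\infty]$, $$\mathcal{P}^{\gamma}\left[\mathcal{A}_r(x)\right]\le \mathbb{P}^{\eta}_{(\lambda)}\left[\mathcal{A}_r(x)\right].$$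
   Context: ARW process. Given a triplet $\eta=(S,\eta_0,P)$ ($S$ a countable graph, $\eta_0:S\to\mathbb{N}\cup\{0\}$ an initial occupation, $P$ a transition kernel for a Markov process on $S$) and a sleep rate $\lambda\in(0,\infty]$: at time $0$ there are $\eta_0(x)$ particles at each vertex $x$. Each particle is active or sleeping. Each particle is assigned an independent rate one Poisson clock which, together with $P$, determines the evolution of the particle when it is active: active particles perform independent, rate one, walks with kernel $P$. Sleeping particles stay put. For $\lambda<\infty$, all particles begin as active; active particles fall asleep independently at rate $\lambda$, except that an active particle never falls asleep if it is not alone at a vertex; a sleeping particle remains sleeping as long as it is alone at its vertex; if two or more particles occupy the same vertex they are all active (so a sleeping particle is activated by an active particle that jumps to its vertex). For $\lambda=\infty$, a particle is sleeping if and only if it is alone at a vertex. The law of the process is $\mathbb{P}^{\eta}_{(\lambda)}$. It is assumed that the ARW process defined by $\eta_0$ and $P$ is well defined (in particular, that infinitely many particles do not reach some vertex in finite time). For the ARW, $\mathcal{A}_r(x)$ is the event that $x$ is visited by an active particle at least $r$ distinct times. MSIA process. Given a triplet $\gamma=(S,\gamma_0,P)$ with $\sum_{x\in S}\gamma_0(x)<\infty$: begin with a finite number of indistinguishable explorers occupying vertices of $S$ according to the initial occupation $\gamma_0$. If a vertex contains more than one explorer, then one of the explorers at that vertex begins a walk according to the kernel $P$ until reaching an unoccupied vertex, where it remains forever. Some fixed ordering of the vertices of $S$ is assumed, and the explorers perform these walks one at a time by this order. This continues until each vertex has at most one explorer. The ordering is arbitrary; the statement is true for any fixed ordering. The law of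 the process is $\mathcal{P}^{\gamma}$. For the MSIA process, $\mathcal{A}_r(x)$ is the event that vertex $x$ is visited by at least $r$ explorers. *)

(* Defs.v *)
From HB Require Import structures.
From mathcomp Require Import all_boot all_order all_algebra.
From mathcomp Require Import all_classical all_reals all_analysis.
Import Order.TTheory GRing.Theory Num.Theory.
Import numFieldNormedType.Exports.
Set Implicit Arguments.
Unset Strict Implicit.
Unset Printing Implicit Defensive.
Local Open Scope classical_set_scope.
Local Open Scope ring_scope.

Definition stochastic {R : realType} {S : choiceType} (p : S -> S -> R) :
    Prop :=
  (forall y z, 0 <= p y z) /\
  (forall y, (\esum_(z in [set: S]) (p y z)%:E = 1)%E).

Definition total_order {S : Type} (leS : rel S) : Prop :=
  [/\ reflexive leS, antisymmetric leS, transitive leS & total leS].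

(* ** Activated random walk *)

(* The particles of the initial occupation [eta0]; [tag i] is the starting
   vertex of [i]. *)
Definition particle {S : countType} (eta0 : S -> nat) : Type :=
  {x : S & 'I_(eta0 x)}.

Definition filtration {d : measure_display} {Omega : measurableType d}
    {R : realType} (F : R -> set (set Omega)) : Prop :=
  [/\ forall t, sigma_algebra [set: Omega] (F t),
      forall s t, s <= t -> F s `<=` F t &
      forall t A, F t A -> measurable A].

(* The sigma-algebra F_{T-} of the events strictly prior to a positive random
   time [T]. *)
Definition strict_past {d : measure_display} {Omega : measurableType d}
    {R : realType} (F : R -> set (set Omega)) (T : Omega -> R) :
    set (set Omega) :=
  <<s [set A | exists t B,
        [/\ 0 <= t, F t B & A = B `&` [set w | t < T w]]] >>.

(* [T j n] is the time of the n-th ring of clock [j].  The clocks are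
   independent Poisson processes of rates [rate j] with respect to [F]: the
   numbers of rings in ]s, t] are independent Poisson variables, jointly
   independent of [F s]. *)
Definition poisson_clocks {d : measure_display} {Omega : measurableType d}
    {R : realType} (P : probability Omega R) (F : R -> set (set Omega))
    {J : eqType} (rate : J -> R) (T : J -> nat -> Omega -> R) : Prop :=
  [/\ forall j w, 0 < T j 0%N w,
      forall j n w, T j n w < T j n.+1 w,
      forall j w, T j n w @[n --> \oo] --> +oo,
      forall j n t, 0 <= t -> F t [set w | T j n w <= t] &
      forall (s t : R) (B : set Omega) (D : seq J) (k : J -> nat),
        0 <= s -> s < t -> F s B -> uniq D ->
        P (B `&` \bigcap_(j in [set` D])
                   [set w | ([set n | s < T j n w <= t] #= `I_(k j))%card]) =
        (P B * (\prod_(j <- D) poisson_pmf (rate j * (t - s)) (k j))%:E)%E].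

(* Just before time [t], particle [i] is at [y] with status [b] ([true] means
   active, [false] sleeping). *)
Definition before {R : realType} {S : countType} {I Omega : Type}
    (pos : I -> R -> Omega -> S) (active : I -> R -> Omega -> bool)
    (i : I) (t : R) (w : Omega) (y : S) (b : bool) : Prop :=
  \forall s \near t^'-, pos i s w = y /\ active i s w = b.

Definition alone {R : realType} {S : countType} {I Omega : Type}
    (pos : I -> R -> Omega -> S) (i : I) (t : R) (w : Omega) : Prop :=
  forall j, pos j t w = pos i t w -> j = i.

(* A realization, on the probability space [P], of the ARW process with kernel
   [p], initial occupation [eta0] and sleep rate [lambda].  Each particle has
   a rate 1 jump clock and, if [lambda] is finite, a rate [lambda] sleep clock;
   rings at which the particle cannot act are ignored. *)
Record arw {R : realType} {S : countType} (p : S -> S -> R) (eta0 : S -> nat)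
    (lambda : \bar R) {d : measure_display} {Omega : measurableType d}
    (P : probability Omega R) := ARW {
  arw_filt : R -> set (set Omega) ;
  arw_pos : particle eta0 -> R -> Omega -> S ;
  arw_active : particle eta0 -> R -> Omega -> bool ;
  arw_jump_ring : particle eta0 -> nat -> Omega -> R ;
  (* irrelevant when [lambda] is infinite *)
  arw_sleep_ring : particle eta0 -> nat -> Omega -> R ;

  arw_filtration : filtration arw_filt ;
  arw_pos_adapted : forall i t y, 0 <= t ->
    arw_filt t [set w | arw_pos i t w = y] ;
  arw_active_adapted : forall i t, 0 <= t ->
    arw_filt t [set w | arw_active i t w] ;
  arw_clocks :
    match lambda with
    | EFin l =>
        poisson_clocks P arw_filt
          (fun c : particle eta0 + particle eta0 =>
             if c is inl _ then 1 else l)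
          (fun c => match c with
                    | inl i => arw_jump_ring i
                    | inr i => arw_sleep_ring i
                    end)
    | _ => poisson_clocks P arw_filt (fun=> 1) arw_jump_ring
    end ;

  arw_right_continuous : forall i t w, 0 <= t ->
    \forall s \near t^'+,
      arw_pos i s w = arw_pos i t w /\ arw_active i s w = arw_active i t w ;
  arw_left_limit : forall i t w, 0 < t ->
    exists y b, before arw_pos arw_active i t w y b ;
  arw_locally_finite : forall x t w,
    finite_set [set i | exists2 s, 0 <= s <= t & arw_pos i s w = x] ;

  arw_pos_init : forall i w, arw_pos i 0 w = tag i ;
  arw_stay : forall i t w y b, 0 < t -> before arw_pos arw_active i t w y b ->
    ~ (b /\ exists n, arw_jump_ring i n w = t) -> arw_pos i t w = y ;
  (* A ring of an active particle at [y] moves it to [z] with conditional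
     probability [p y z] given the past. *)
  arw_jump : forall i n y z E,
    strict_past arw_filt (arw_jump_ring i n) E ->
    (forall w, E w ->
       before arw_pos arw_active i (arw_jump_ring i n w) w y true) ->
    P (E `&` [set w | arw_pos i (arw_jump_ring i n w) w = z]) =
    (P E * (p y z)%:E)%E ;
  arw_status :
    match lambda with
    | EFin _ =>
        (forall i w, arw_active i 0 w) /\
        (forall i t w y b, 0 < t -> before arw_pos arw_active i t w y b ->
           ~~ arw_active i t w <->
           alone arw_pos i t w /\ (~~ b \/ exists n, arw_sleep_ring i n w = t))
    | _ => forall i t w, 0 <= t -> ~~ arw_active i t w <-> alone arw_pos i t w
    end
}.

(* Visits are arrivals, i.e. jumps to [x]: initial positions are not counted,
   here or in [msia_visits] below.  The jumping particle is active just before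
   [t]; for [lambda = +oo] it may be asleep from [t] on. *)
Definition arw_visit {R : realType} {S : countType} {p : S -> S -> R}
    {eta0 : S -> nat} {lambda : \bar R} {d : measure_display}
    {Omega : measurableType d} {P : probability Omega R}
    (X : arw p eta0 lambda P) (x : S) (t : R) (w : Omega) : Prop :=
  exists i n y,
    [/\ arw_jump_ring X i n w = t,
        before (arw_pos X) (arw_active X) i t w y true &
        arw_pos X i t w = x].

Definition arw_visited {R : realType} {S : countType} {p : S -> S -> R}
    {eta0 : S -> nat} {lambda : \bar R} {d : measure_display}
    {Omega : measurableType d} {P : probability Omega R}
    (X : arw p eta0 lambda P) (r : int) (x : S) : set Omega :=
  [set w | exists ts : seq R,
     [/\ uniq ts, r <= (size ts)%:Z & forall t, t \in ts -> arw_visit X x t w]].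

(* ** Multiple source internal aggregation *)

(* Independent walks with kernel [p], one for each explorer number [k] and each
   vertex [v] it may have to start from. *)
Record explorer_walks {R : realType} {S : countType} (p : S -> S -> R)
    {d : measure_display} {Omega : measurableType d}
    (P : probability Omega R) := ExplorerWalks {
  walk :> nat -> S -> nat -> Omega -> S ;
  walk_measurable : forall k v n y, measurable [set w | walk k v n w = y] ;
  walk_law : forall (D : seq (nat * S)) (n : nat) (path : nat * S -> nat -> S),
    uniq D ->
    P (\bigcap_(a in [set` D]) \bigcap_(m in `I_n.+1)
         [set w | walk a.1 a.2 m w = path a m]) =
    (\prod_(a <- D) ((path a 0%N == a.2)%:R *
                     \prod_(m < n) p (path a m) (path a m.+1)))%:E
}.

(* [c] is an occupation (number of explorers at each vertex). *)
Definition msia_next {S : countType} (leS : rel S) (c : S -> nat) (v : S) :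
    Prop :=
  (1 < c v)%N /\ forall u, (1 < c u)%N -> leS v u.

(* Since [1 < c v] at the starting vertex [v], it makes no difference that [c]
   still counts the walking explorer at [v]. *)
Definition msia_still_walking {S : countType} (c : S -> nat) (path : nat -> S)
    (n : nat) : Prop :=
  forall m, (0 < m < n)%N -> c (path m) <> 0%N.

Definition msia_move {S : countType} (c : S -> nat) (v z : S) (u : S) : nat :=
  (c u - (u == v) + (u == z))%N.

(* [msia_occupation leS gamma0 W k c]: the first [k] explorers to walk have all
   settled, leaving the occupation [c]. *)
Inductive msia_occupation {S : countType} (leS : rel S) (gamma0 : S -> nat)
    (W : nat -> S -> nat -> S) : nat -> (S -> nat) -> Prop :=
| msia_start : msia_occupation leS gamma0 W 0%N gamma0
| msia_step k c v n :
    msia_occupation leS gamma0 W k c -> msia_next leS c v ->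
    (0 < n)%N -> msia_still_walking c (W k v) n -> c (W k v n) = 0%N ->
    msia_occupation leS gamma0 W k.+1 (msia_move c v (W k v n)).

Definition msia_visits {S : countType} (leS : rel S) (gamma0 : S -> nat)
    (W : nat -> S -> nat -> S) (k : nat) (x : S) : Prop :=
  exists c v n,
    [/\ msia_occupation leS gamma0 W k c, msia_next leS c v, (0 < n)%N,
        msia_still_walking c (W k v) n & W k v n = x].

Definition msia_visited {R : realType} {S : countType} {p : S -> S -> R}
    {d : measure_display} {Omega : measurableType d} {P : probability Omega R}
    (leS : rel S) (gamma0 : S -> nat) (W : explorer_walks p P)
    (r : int) (x : S) : set Omega :=
  [set w | exists ks : seq nat,
     [/\ uniq ks, r <= (size ks)%:Z &
         forall k, k \in ks ->
           msia_visits leS gamma0 (fun k v n => W k v n w) k x]].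

(* Main.v *)
Require Import Defs.
From HB Require Import structures.
From mathcomp Require Import all_boot all_order all_algebra.
From mathcomp Require Import all_classical all_reals all_analysis.
From mathcomp Require Import zify ring lra.
Import Order.TTheory GRing.Theory Num.Theory.
Local Open Scope classical_set_scope.
Local Open Scope ring_scope.
Set Implicit Arguments.
Unset Strict Implicit.
Unset Printing Implicit Defensive.

(** Both processes are driven by moves of single particles that are chosen with
    the kernel [p], and the comparison is the abelian property of such systems.

    An explorer walks only over occupied vertices, so each of its steps topples a
    vertex that holds at least two particles ([legal_stopped]). The event that
    [r] explorers visit [x] is therefore the disjoint union of the events that
    the aggregation follows a given finite history of moves, over a countable
    prefix-free set of legal histories ([msia_visitedP], [stopped_diverge]), and
    it follows a history with probability at most the product of the
    probabilities of its moves ([follows_le]).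

    The walkers of the other process are read as a system of stacks as well: the
    [k]-th departure from a vertex uses the [k]-th instruction there. A history
    is realized when, at every vertex it topples, the first departures go where
    it prescribes, in whatever order the vertices are left. A vertex with two
    particles is always left sooner or later, because they are awake as long as
    they are together ([shared_vertex_departure]), whatever the sleep rate.
    Topplings commute and only the toppled vertex loses a particle, so what
    remains of a legal history stays legal for the present configuration when a
    vertex moves ahead of its turn ([legal_spend], [occupied_departure]). Hence
    the next departure required by the history always comes. Given the strict
    past of its ring it goes to the right place with the probability given by
    [p], and by induction on the number of moves a legal history is realized
    with probability at least the product of the probabilities of its moves
    ([realized_ge]).

    Finally, up to the null event that two clocks ring together
    ([no_ties_full]), diverging histories are not realized together
    ([realized_diverge]), and a realized history makes as many visits to [x], at
    distinct times, as it has moves to [x] ([realized_visits]). Summing over the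
    stopped histories gives the inequality. *)

(** * Countable families of events *)

Section countable_families.
Context {d : measure_display} {Omega : measurableType d} {R : realType}.
Context (P : probability Omega R).

(** Sums over an arbitrary countable type are compared with measures through
    the enumeration [pickle], the countable additivity of a measure being
    stated for sequences. *)
Lemma esum_unpickle {T : countType} (f : T -> \bar R) :
  \esum_(t in [set: T]) f t =
  \esum_(n in [set: nat]) (if @pickle_inv T n is Some t then f t else 0%E).
Proof.
have -> : \esum_(n in [set: nat])
    (if @pickle_inv T n is Some t then f t else 0%E) =
  \esum_(n in pickle @` [set: T])
    (if @pickle_inv T n is Some t then f t else 0%E).
  rewrite [RHS]esum_mkcond; apply: eq_esum => n _.
  case: ifPn => //; case E : (@pickle_inv T n) => [t|//].
  rewrite notin_setE/=; case; exists t => //.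
  by have := @pickle_invK T n; rewrite E.
rewrite esum_image; last by move=> x y _ _; exact: (pcan_inj pickleK).
by apply: eq_esum => t _; rewrite pickleK_inv.
Qed.

Lemma esumZl {T : countType} (c : R) (f : T -> \bar R) :
  (forall t, (0 <= f t)%E) -> 0 <= c ->
  \esum_(t in [set: T]) (c%:E * f t)%E = (c%:E * \esum_(t in [set: T]) f t)%E.
Proof.
move=> f0 c0; have cf0 t : (0 <= c%:E * f t)%E.
  by rewrite mule_ge0 ?lee_fin.
rewrite [LHS]esum_unpickle [X in (_ * X)%E]esum_unpickle -!nneseries_esumT.
- rewrite -nneseriesZl; last by move=> n _; case: pickle_inv.
  by apply: eq_eseriesr => n _; case: pickle_inv => //; rewrite mule0.
- by move=> n; case: pickle_inv.
- by move=> n; case: pickle_inv.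
Qed.

Lemma le_measure_esum {T : countType} (A : T -> set Omega) (B : set Omega) :
  measurable B -> (forall t, measurable (A t)) -> B `<=` \bigcup_t A t ->
  (P B <= \esum_(t in [set: T]) P (A t))%E.
Proof.
move=> mB mA BA.
pose G n := if @pickle_inv T n is Some t then A t else set0.
have mG n : measurable (G n) by rewrite /G; case: pickle_inv.
rewrite esum_unpickle -nneseries_esumT; last by move=> n; case: pickle_inv.
rewrite [leRHS](_ : _ = (\sum_(n <oo) P (G n))%E); last first.
  by apply: eq_eseriesr => n _; rewrite /G; case: pickle_inv.
apply: measure_sigma_subadditive => // w /BA[t _ At].
by exists (pickle t) => //; rewrite /G pickleK_inv.
Qed.

Lemma esum_le_measure {T : choiceType} (A : T -> set Omega) (B : set Omega) :
  measurable B -> (forall t, measurable (A t)) -> trivIset setT A ->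
  \bigcup_t A t `<=` B ->
  (\esum_(t in [set: T]) P (A t) <= P B)%E.
Proof.
move=> mB mA tA AB; apply: ge_ereal_sup => _ [X [finX _] <-].
rewrite -measure_fin_bigcup//; last exact: sub_trivIset tA.
apply: le_measure; rewrite ?inE//; first exact: fin_bigcup_measurable.
by move=> w [t Xt At]; apply: AB; exists t.
Qed.

Lemma null_exists {T : countType} (A : T -> set Omega) :
  (forall t, measurable (A t)) -> (forall t, P (A t) = 0%E) ->
  P [set w | exists t, A t w] = 0%E.
Proof.
move=> mA A0; have U : [set w | exists t, A t w] `<=` \bigcup_t A t.
  by move=> w [t At]; exists t.
have mU : measurable [set w | exists t, A t w].
  rewrite (_ : mkset _ = \bigcup_t A t); last first.
    by apply/seteqP; split => // w [t _ At]; exists t.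
  exact: countable_bigcupT_measurable (countableP _) mA.
apply/eqP; rewrite eq_le measure_ge0 andbT.
apply: le_trans (le_measure_esum mU mA U) _.
by rewrite esum1.
Qed.

Lemma measure_setI_full (A N : set Omega) : measurable A -> measurable N ->
  P (~` N) = 0%E -> P (A `&` N) = P A.
Proof.
move=> mA mN N0; have D0 : P (A `\` N) = 0%E.
  apply/eqP; rewrite eq_le measure_ge0 andbT -N0.
  by apply: le_measure; rewrite ?inE; [exact: measurableD|exact: measurableC|
    move=> w []].
by rewrite -[LHS]add0e -D0; exact/esym/measureDI.
Qed.

End countable_families.

(** Events are shown measurable by following the formulas that define them:
    every rule below is closure of a sigma-algebra under one connective or one
    quantifier over a countable type. *)
Section sigma_algebra_formulas.
Context {Omega : Type} {G : set (set Omega)}.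
Hypothesis sG : sigma_algebra setT G.

Lemma salg0 : G set0. Proof. by case: sG. Qed.

Lemma salg_not A : G A -> G [set w | ~ A w].
Proof. by case: sG => _ /[swap] _ GD /GD; rewrite setTD. Qed.

Lemma salg_const (Q : Prop) : G [set _ | Q].
Proof.
have GT : G setT by have := salg_not salg0; rewrite -[X in G X]/(~` set0) setC0.
have [q|nq] := pselect Q.
  by rewrite (_ : mkset _ = setT) //; apply/seteqP; split.
by rewrite (_ : mkset _ = set0) //; [exact: salg0|apply/seteqP; split].
Qed.

Lemma salg_exists {T : countType} (A : T -> set Omega) :
  (forall t, G (A t)) -> G [set w | exists t, A t w].
Proof.
move=> GA; case: sG => G0 _ GU.
pose B n := if @pickle_inv T n is Some t then A t else set0.
have -> : [set w | exists t, A t w] = \bigcup_n B n.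
  apply/seteqP; split => [w [t At]|w [n _]].
    by exists (pickle t) => //; rewrite /B pickleK_inv.
  by rewrite /B; case: pickle_inv => // t At; exists t.
by apply: GU => n; rewrite /B; case: pickle_inv.
Qed.

Lemma salg_forall {T : countType} (A : T -> set Omega) :
  (forall t, G (A t)) -> G [set w | forall t, A t w].
Proof.
move=> GA; have := @salg_exists T (fun t => [set w | ~ A t w]).
move=> /(_ (fun t => salg_not (GA t))) /salg_not.
congr G; apply/seteqP; split => w /=; last by move=> Aw [t]; exact.
by move=> nA t; apply: contrapT => nAt; apply: nA; exists t.
Qed.

Lemma salg_or A B : G A -> G B -> G [set w | A w \/ B w].
Proof.
move=> GA GB; have := @salg_exists bool (fun b => if b then A else B).
move=> H; have {H} := H (fun b => if b as b return G (if b then A else B)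
  then GA else GB).
congr G; apply/seteqP; split => w /=; first by case=> -[]; [left|right].
by case=> ?; [exists true|exists false].
Qed.

Lemma salg_and A B : G A -> G B -> G [set w | A w /\ B w].
Proof.
move=> GA GB; have := salg_not (salg_or (salg_not GA) (salg_not GB)).
congr G; apply/seteqP; split => w /=; last by move=> [Aw Bw] [].
by move=> H; split; apply: contrapT => ?; apply: H; [left|right].
Qed.

Lemma salg_imply A B : G A -> G B -> G [set w | A w -> B w].
Proof.
move=> GA GB; have := salg_or (salg_not GA) GB.
congr G; apply/seteqP; split => w /=; first by case.
by have [Aw AB|] := pselect (A w); [right; exact: AB|left].
Qed.

Lemma salg_seq_all {T : eqType} (A : T -> set Omega) (s : seq T) :
  (forall t, t \in s -> G (A t)) -> G [set w | forall t, t \in s -> A t w].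
Proof.
elim: s => [|x s IH] GA; first by have := salg_const True; congr G;
  apply/seteqP; split.
have {IH} IH := IH (fun t ts => GA t (mem_behead (s := x :: s) ts)).
have := salg_and (GA _ (mem_head x s)) IH.
congr G; apply/seteqP; split => w /=.
  by move=> [Ax As] t; rewrite inE => /predU1P[->//|]; exact: As.
move=> H; split; first by apply: H; exact: mem_head.
by move=> t ts; apply: H; rewrite inE ts orbT.
Qed.

End sigma_algebra_formulas.

(** * Internal aggregation as a process of single steps *)

Section topplings.
Context {S : countType}.

(** Integer values make topplings commute, even when a vertex topples with too
    few particles. *)
Definition topple (c : S -> int) (e : S * S) (u : S) : int :=
  c u - (u == e.1)%:R + (u == e.2)%:R.

Fixpoint legal (c : S -> int) (h : seq (S * S)) : Prop :=
  if h is e :: h' then 2 <= c e.1 /\ legal (topple c e) h' else True.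

(** Diverging histories prescribe different destinations for the same departure,
    say the [k]-th one from [v], so that no realization obeys both. *)
Definition diverge (h h' : seq (S * S)) : Prop :=
  exists g v z z' h1 h2,
    [/\ z != z', h = g ++ (v, z) :: h1 & h' = g ++ (v, z') :: h2].

End topplings.

Section aggregation_steps.
Context {S : countType} (leS : rel S) (x : S).

(** A walker [Some (v, y, n)] is explorer number [as_explorer]: it started at
    [v], where [as_occ] still counts it, and stands at [y] after [n] steps.
    Without a walker the process has stopped. *)
Record agg_state := AggState {
  as_explorer : nat ;
  as_occ : S -> nat ;
  as_visitors : seq nat ; (* the explorers that have visited [x] *)
  as_walker : option (S * S * nat) }.

Definition next_source (c : S -> nat) : option S :=
  if pselect (exists v, msia_next leS c v) is left ex then Some (projT1 (cid ex))
  else None.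

Definition launch (c : S -> nat) : option (S * S * nat) :=
  omap (fun v => (v, v, 0%N)) (next_source c).

Definition agg_start (c : S -> nat) := AggState 0 c [::] (launch c).

Definition agg_step (st : agg_state) (z : S) : agg_state :=
  let: AggState k c s o := st in
  if o is Some (v, y, n) then
    let s' := if (z == x) && (k \notin s) then k :: s else s in
    if c z == 0%N then
      AggState k.+1 (msia_move c v z) s' (launch (msia_move c v z))
    else AggState k c s' (Some (v, z, n.+1))
  else st.

(** The occupation with the walker counted where it stands, so that one step of
    the process is one toppling. *)
Definition agg_config (st : agg_state) (u : S) : int :=
  (as_occ st u)%:Z +
  (if as_walker st is Some (v, y, _) then (u == y)%:R - (u == v)%:R else 0).

Definition agg_wf (st : agg_state) : Prop :=
  if as_walker st is Some (v, y, n) then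
    msia_next leS (as_occ st) v /\ as_occ st y <> 0%N
  else True.

(** The histories from [st] that end as soon as [r] explorers have visited [x].
    Stopping there makes them prefix-free, hence the events that they define
    disjoint. *)
Fixpoint stopped (r : int) (st : agg_state) (h : seq (S * S)) : Prop :=
  if h is e :: h' then
    [/\ ~ r <= (size (as_visitors st))%:Z,
        exists v n, as_walker st = Some (v, e.1, n) &
        stopped r (agg_step st e.2) h']
  else r <= (size (as_visitors st))%:Z.

Fixpoint follows (Wf : nat -> S -> nat -> S) (st : agg_state)
    (h : seq (S * S)) : Prop :=
  if h is e :: h' then
    (exists v y n, as_walker st = Some (v, y, n) /\
       Wf (as_explorer st) v n.+1 = e.2) /\ follows Wf (agg_step st e.2) h'
  else True.

Definition advance (Wf : nat -> S -> nat -> S) (st : agg_state) : agg_state :=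
  if as_walker st is Some (v, _, n) then
    agg_step st (Wf (as_explorer st) v n.+1)
  else st.

Lemma next_sourceP c v : next_source c = Some v -> msia_next leS c v.
Proof. by rewrite /next_source; case: pselect => // ex [<-]; case: cid. Qed.

Lemma next_source_eq c v : total_order leS -> msia_next leS c v ->
  next_source c = Some v.
Proof.
move=> [_ anti _ _] cv; rewrite /next_source; case: pselect => [ex|]; last first.
  by case; exists v.
case: cid => u /= [cu lu]; case: cv => cv lv; congr Some.
by apply: anti; rewrite lu ?lv.
Qed.

Lemma agg_wf_launch k c s : agg_wf (AggState k c s (launch c)).
Proof.
rewrite /agg_wf /launch /=; case E : next_source => [v|] //=.
have cv := next_sourceP E; split => //.
by case: cv => + _; case: (c v).
Qed.

Lemma agg_wf_step st z : agg_wf st -> agg_wf (agg_step st z).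
Proof.
case: st => k c s [[[v y] n]|] //; rewrite /agg_step => -[/= cv cy].
by case: eqP => cz; [exact: agg_wf_launch|].
Qed.

Lemma agg_config_launch k c s u :
  agg_config (AggState k c s (launch c)) u = (c u)%:Z.
Proof.
by rewrite /agg_config /launch /=; case: next_source => [v|] /=;
  rewrite ?subrr addr0.
Qed.

Lemma agg_config_step st z v y n :
  agg_wf st -> as_walker st = Some (v, y, n) ->
  agg_config (agg_step st z) = topple (agg_config st) (y, z).
Proof.
case: st => k c s o /= + ow; rewrite /agg_wf /= ow => -[[cv _] cy].
apply/funext => u; rewrite /topple /agg_step; case: eqP => cz.
  rewrite agg_config_launch /agg_config /msia_move /=.
  case: (eqVneq u v) => uv; case: (u == z); case: (u == y); 
    rewrite ?uv /=; lia.
by rewrite /agg_config /=; case: (u == v); case: (u == z); case: (u == y) => /=;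
  lia.
Qed.

(** A walking explorer topples the vertex where it stands, which another
    explorer occupies: it has not settled there, and its starting vertex holds
    a second explorer. *)
Lemma legal_stopped r st h : agg_wf st -> stopped r st h ->
  legal (agg_config st) h.
Proof.
elim: h st => [//|[y z] h IH] st wf /= [_ [v [n ow]] gh]; split; last first.
  by rewrite -(agg_config_step z wf ow); apply: IH => //; exact: agg_wf_step.
move: wf; rewrite /agg_wf ow /agg_config ow eqxx => -[[cv _] cy].
by case: (eqVneq y v) => [->|] /=; lia.
Qed.

Lemma size_visitors_step st z :
  (size (as_visitors (agg_step st z)) <= size (as_visitors st) + (z == x))%N.
Proof.
case: st => k c s [[[v y] n]|] /=; last by rewrite leq_addr.
by case: (c z == _) => /=; case: eqP => //=; case: (k \notin s) => /=; lia.
Qed.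

Lemma count_stopped r st h : stopped r st h ->
  r <= (size (as_visitors st) + count (fun e => e.2 == x) h)%:Z.
Proof.
elim: h st => [|e h IH] st /=; first by rewrite addn0.
move=> [_ _ /IH rh]; apply: le_trans rh _.
by rewrite lez_nat addnA leq_add2r size_visitors_step.
Qed.

(** The state decides which vertex topples next, so only its destination can
    tell two histories apart. *)
Lemma stopped_diverge r st h h' : stopped r st h -> stopped r st h' ->
  h <> h' -> diverge h h'.
Proof.
elim: h h' st => [|[y z] h IH] [|[y' z'] h'] st //=.
- by move=> rs [].
- by move=> [nrs _ _] /nrs.
move=> [_ [v [n ow]] gh] [_ [v' [n' ow']] gh'] neq.
have yy' : y = y' by move: ow'; rewrite ow => -[].
subst y'.
have [zz'|zz'] := eqVneq z z'; last by exists [::], y, z, z', h, h'.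
subst z'; have hh' : h <> h' by move=> hh'; apply: neq; rewrite hh'.
have [g [u [t [t' [h1 [h2 [tt' -> ->]]]]]]] := IH _ _ gh gh' hh'.
by exists ((y, z) :: g), u, t, t', h1, h2.
Qed.

Section run.
Context (Wf : nat -> S -> nat -> S).

Lemma stopped_of_run r st j :
  r <= (size (as_visitors (iter j (advance Wf) st)))%:Z ->
  exists h, stopped r st h /\ follows Wf st h.
Proof.
elim: j st => [|j IH] st; first by exists [::].
have [rs _|nrs] := pselect (r <= (size (as_visitors st))%:Z).
  by exists [::].
rewrite iterSr {2}/advance; case ow : (as_walker st) => [[[v y] n]|].
  move=> /IH[h [gh fh]]; exists ((y, Wf (as_explorer st) v n.+1) :: h).
  by split; split => //; [exists v, n|exists v, y, n].
by move=> /IH.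
Qed.

Lemma run_of_stopped r st h : stopped r st h -> follows Wf st h ->
  exists j, r <= (size (as_visitors (iter j (advance Wf) st)))%:Z.
Proof.
elim: h st => [|e h IH] st /=; first by exists 0%N.
move=> [_ _ gh] [[v [y [n [ow We]]]] fh].
have [j rj] := IH _ gh fh; exists j.+1.
by rewrite iterSr {2}/advance ow We.
Qed.

Lemma visitors_advance st : {subset as_visitors st <= as_visitors (advance Wf st)}.
Proof.
move=> i; rewrite /advance; case: st => k c s [[[v y] n]|] //= is_.
by case: ifP => _ /=; case: ifP => _ //; rewrite inE is_ orbT.
Qed.

Lemma visitors_iter st i j : (i <= j)%N ->
  {subset as_visitors (iter i (advance Wf) st) <=
          as_visitors (iter j (advance Wf) st)}.
Proof.
move=> /subnK <-; elim: (j - i)%N => [|m IH] k ks //.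
by rewrite addSn iterS; apply: visitors_advance; exact: IH.
Qed.

Definition agg_reached (gamma0 : S -> nat) (st : agg_state) : Prop :=
  [/\ uniq (as_visitors st),
      forall k, k \in as_visitors st -> msia_visits leS gamma0 Wf k x,
      msia_occupation leS gamma0 Wf (as_explorer st) (as_occ st) &
      if as_walker st is Some (v, y, n) then
        msia_next leS (as_occ st) v /\
        msia_still_walking (as_occ st) (Wf (as_explorer st) v) n.+1
      else True].

Lemma agg_reached_start gamma0 : agg_reached gamma0 (agg_start gamma0).
Proof.
split => //=; first exact: msia_start.
rewrite /launch; case E : next_source => [v|] //=; split.
  exact: next_sourceP.
by move=> m; lia.
Qed.

Lemma agg_reached_advance gamma0 st :
  agg_reached gamma0 st -> agg_reached gamma0 (advance Wf st).
Proof.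
case: st => k c s [[[v y] n]|] // [/= us vs occ [cv still]].
rewrite /advance /=.
set z := Wf k v n.+1; set s' := if _ then _ else s.
have us' : uniq s' by rewrite /s'; case: ifP => //= /andP[_ ->].
have vs' i : i \in s' -> msia_visits leS gamma0 Wf i x.
  rewrite /s'; case: ifP => [/andP[/eqP zx _]|_]; last exact: vs.
  rewrite inE => /predU1P[->|]; last exact: vs.
  by exists c, v, n.+1.
case: eqP => cz; split => //=.
- exact: msia_step.
- rewrite /launch; case E : next_source => [u|] //=; split.
    exact: next_sourceP.
  by move=> m; lia.
- split => // m; rewrite ltnS [X in _ && X]leq_eqVlt => /andP[m0 /predU1P[->//|mn]].
  by apply: still; rewrite m0.
Qed.

Lemma agg_reached_run gamma0 j :
  agg_reached gamma0 (iter j (advance Wf) (agg_start gamma0)).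
Proof.
elim: j => [|j IH]; first exact: agg_reached_start.
by rewrite iterS; exact: agg_reached_advance.
Qed.

Lemma run_still_walking k c s v n : total_order leS -> msia_next leS c v ->
  msia_still_walking c (Wf k v) n -> forall m, (m < n)%N ->
  exists y s', iter m (advance Wf) (AggState k c s (launch c)) =
               AggState k c s' (Some (v, y, m)).
Proof.
move=> tS cv still; elim=> [|m IH] mn /=.
  by exists v, s; rewrite /launch (next_source_eq tS cv).
have [y [s' ->]] := IH (ltnW mn).
rewrite /advance /= ifN; first by eexists; eexists; reflexivity.
by apply/eqP; apply: still.
Qed.

Lemma run_occupation gamma0 k c : total_order leS ->
  msia_occupation leS gamma0 Wf k c ->
  exists j s, iter j (advance Wf) (agg_start gamma0) = AggState k c s (launch c).
Proof.
move=> tS; elim=> [|{}k {}c v [//|n] _ [j [s js]] cv _ still settled].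
  by exists 0%N, [::].
have [y [s' E]] := run_still_walking s tS cv still (ltnSn n).
exists (n.+1 + j)%N; rewrite iterD js iterS E /advance /= settled eqxx.
by eexists.
Qed.

Lemma msia_visits_run gamma0 k : total_order leS ->
  msia_visits leS gamma0 Wf k x ->
  exists j, k \in as_visitors (iter j (advance Wf) (agg_start gamma0)).
Proof.
move=> tS [c [v [n [occ cv]]]]; case: n => [//|n] _ still at_x.
have [j [s js]] := run_occupation tS occ.
have [y [s' E]] := run_still_walking s tS cv still (ltnSn n).
exists (n.+1 + j)%N; rewrite iterD js iterS E /advance /= at_x eqxx /=.
by case: ifP => _ /=; case: ifPn => [_|/negPn]; rewrite ?mem_head.
Qed.

(** Writes the event that [r] explorers visit [x] as a countable union over
    stopped histories. A run is followed until the last explorer of [ks] has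
    visited [x]; the visitors recorded on the way can only become more. *)
Lemma msia_visitedP gamma0 r : total_order leS ->
  (exists ks : seq nat, [/\ uniq ks, r <= (size ks)%:Z &
     forall k, k \in ks -> msia_visits leS gamma0 Wf k x]) <->
  (exists h, stopped r (agg_start gamma0) h /\
             follows Wf (agg_start gamma0) h).
Proof.
move=> tS; split=> [[ks [uks rks vks]]|[h [gh fh]]]; last first.
  have [j rj] := run_of_stopped gh fh.
  have [us vs _ _] := agg_reached_run gamma0 j.
  by exists (as_visitors (iter j (advance Wf) (agg_start gamma0))).
suff [j js] : exists j, {subset ks <=
    as_visitors (iter j (advance Wf) (agg_start gamma0))}.
  apply: (@stopped_of_run _ _ j); apply: le_trans rks _.
  by rewrite lez_nat; exact: uniq_leq_size.
elim: ks vks {uks rks} => [|k ks IH] vks; first by exists 0%N.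
have [j js] := IH (fun i iks => vks i (mem_behead (s := k :: ks) iks)).
have [i ki] := msia_visits_run tS (vks k (mem_head _ _)).
exists (maxn i j) => l; rewrite inE => /predU1P[->|/js].
  exact: visitors_iter (leq_maxl _ _) _ ki.
exact: visitors_iter (leq_maxr _ _) _.
Qed.

End run.
End aggregation_steps.

(** * The law of the histories of the aggregation *)

Section history_law.
Context {R : realType} {S : countType} {p : S -> S -> R}.
Context {d : measure_display} {Omega : measurableType d}.
Context {P : probability Omega R} (W : explorer_walks p P).
Hypothesis stoch_p : stochastic p.

Definition history_weight (h : seq (S * S)) : R := \prod_(e <- h) p e.1 e.2.

Let p_ge0 y z : 0 <= p y z. Proof. by case: stoch_p. Qed.

Lemma history_weight_ge0 h : 0 <= history_weight h.
Proof. by apply: prodr_ge0. Qed.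

Definition cylinder (D : seq (nat * S)) (len : nat * S -> nat)
    (path : nat * S -> nat -> S) : set Omega :=
  [set w | forall a, a \in D -> forall m, (m <= len a)%N ->
     W a.1 a.2 m w = path a m].

Definition cylinder_weight (D : seq (nat * S)) (len : nat * S -> nat)
    (path : nat * S -> nat -> S) : R :=
  \prod_(a <- D) ((path a 0%N == a.2)%:R *
                  \prod_(m < len a) p (path a m) (path a m.+1)).

Definition longer (len : nat * S -> nat) (a0 : nat * S) (a : nat * S) : nat :=
  (len a + (a == a0))%N.

Definition extend (len : nat * S -> nat) (path : nat * S -> nat -> S)
    (a0 : nat * S) (z : S) (a : nat * S) (m : nat) : S :=
  if (a == a0) && (m == (len a0).+1) then z else path a m.

Lemma measurable_walk k v n y : measurable [set w | W k v n w = y].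
Proof. exact: walk_measurable. Qed.

Lemma measurable_cylinder D len path : measurable (cylinder D len path).
Proof.
rewrite /cylinder; apply: (salg_seq_all (sigma_algebra_measurable Omega)) => a _.
apply: (salg_forall (sigma_algebra_measurable Omega)) => m.
apply: (salg_imply (sigma_algebra_measurable Omega)); last exact: measurable_walk.
exact: (salg_const (sigma_algebra_measurable Omega)).
Qed.

Lemma cylinder_weight_ge0 D len path : 0 <= cylinder_weight D len path.
Proof.
by apply: prodr_ge0 => a _; rewrite mulr_ge0 ?ler0n//; apply: prodr_ge0.
Qed.

Lemma cylinder_extend D len path a0 w :
  cylinder D len path w ->
  cylinder D (longer len a0) (extend len path a0 (W a0.1 a0.2 (len a0).+1 w)) w.
Proof.
move=> Cw a aD m; rewrite /longer /extend.
have [E|aa0] /= := eqVneq a a0; last by rewrite addn0; exact: Cw.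
rewrite addn1 leq_eqVlt ltnS E; have [->//|_ /=] := eqVneq m (len a0).+1.
by rewrite -E; exact: Cw.
Qed.

Lemma cylinder_weight_extend D len path a0 z : uniq D -> a0 \in D ->
  cylinder_weight D (longer len a0) (extend len path a0 z) =
  cylinder_weight D len path * p (path a0 (len a0)) z.
Proof.
move=> uD a0D; rewrite /cylinder_weight !(bigD1_seq a0) //=.
rewrite [LHS]mulrC [RHS]mulrAC [RHS]mulrC; congr (_ * _).
  apply: eq_bigr => a /negPf aa0; rewrite /longer /extend aa0 addn0.
  by [].
rewrite /longer eqxx addn1 big_ord_recr /= /extend !eqxx /= -mulrA.
congr (_ * _); rewrite (ltn_eqF (ltnSn _)); congr (_ * _).
by apply: eq_bigr => -[m /= mn] _; rewrite !ltn_eqF // ltnW.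
Qed.

(** The walks are given by the joint law of their first [n] steps, with one [n]
    for all of them; walks of different lengths are obtained by summing over
    the missing steps. *)
Lemma cylinder_le D len path : uniq D ->
  (P (cylinder D len path) <= (cylinder_weight D len path)%:E)%E.
Proof.
move=> uD; have [N lenN] : exists N, forall a, a \in D -> (len a <= N)%N.
  by exists (\max_(a <- D) len a)%N => a aD; apply: leq_bigmax_seq.
have [k] := ubnP (\sum_(a <- D) (N - len a)); elim: k len path lenN => // k IH.
move=> len path lenN kN.
have [/hasP[a0 a0D lt_a0]|/hasPn all_N] := boolP (has (fun a => len a < N)%N D).
  pose A z := cylinder D (longer len a0) (extend len path a0 z).
  have mC := measurable_cylinder.
  apply: (@le_trans _ _ (\esum_(z in [set: S]) P (A z))%E).
    apply: le_measure_esum => //; first by move=> z; exact: mC.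
    by move=> w Cw; eexists; last exact: (cylinder_extend (a0 := a0) Cw).
  apply: (@le_trans _ _ (\esum_(z in [set: S])
      ((cylinder_weight D len path)%:E * (p (path a0 (len a0)) z)%:E)%E)%E).
    apply: le_esum => z _; rewrite -EFinM -cylinder_weight_extend //.
    apply: IH => [a aD|].
      by rewrite /longer; case: eqP => [->|_]; rewrite ?addn1 ?addn0 ?lenN.
    move: kN; rewrite ltnS; apply: leq_trans.
    rewrite !(bigD1_seq a0) //= -addSn; apply: leq_add.
      by rewrite /longer eqxx; lia.
    by apply: leq_sum => a /negPf aa0; rewrite /longer aa0 addn0.
  rewrite esumZl ?cylinder_weight_ge0//; first by case: stoch_p => _ ->; rewrite mule1.
  by move=> z; rewrite lee_fin.
have lenE a : a \in D -> len a = N.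
  by move=> aD; apply/eqP; rewrite eqn_leq lenN //= leqNgt all_N.
have -> : cylinder D len path = \bigcap_(a in [set` D]) \bigcap_(m in `I_N.+1)
    [set w | W a.1 a.2 m w = path a m].
  by apply/seteqP; split => w Cw a aD m /= => [mN|]; [|rewrite lenE // => mN];
    apply: Cw => //; rewrite lenE.
rewrite walk_law // /cylinder_weight lee_fin le_eqVlt; apply/orP; left; apply/eqP.
by apply: eq_big_seq => a aD; rewrite lenE.
Qed.

(** A walk starts at the prescribed vertex only almost surely, while the process
    takes every explorer to start there. *)
Definition proper_starts : set Omega :=
  [set w | forall a : nat * S, W a.1 a.2 0%N w = a.2].

Lemma measurable_proper_starts : measurable proper_starts.
Proof.
by apply: (salg_forall (sigma_algebra_measurable Omega)) => a; exact: measurable_walk.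
Qed.

Lemma proper_starts_full : P (~` proper_starts) = 0%E.
Proof.
pose A (b : nat * S * S) :=
  [set w | b.2 != b.1.2 /\ W b.1.1 b.1.2 0%N w = b.2].
have mA b : measurable (A b).
  apply: (salg_and (sigma_algebra_measurable Omega)); last exact: measurable_walk.
  exact: (salg_const (sigma_algebra_measurable Omega)).
have -> : ~` proper_starts = [set w | exists b, A b w].
  apply/seteqP; split => w /= => [|[b [bb Wb] /(_ b.1)]]; last first.
    by rewrite Wb; exact/eqP.
  move=> /existsNP[a Wa]; exists (a, W a.1 a.2 0%N w); split => //=.
  exact/eqP.
apply: null_exists => // -[a y].
have [->|ya] := eqVneq y a.2.
  rewrite (_ : A _ = set0) ?measure0 //; apply/seteqP; split => // w [].
  by rewrite eqxx.
apply/eqP; rewrite eq_le measure_ge0 andbT.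
have := @cylinder_le [:: a] (fun=> 0%N) (fun _ _ => y) isT.
rewrite /cylinder_weight big_seq1 (negPf ya) mul0r; apply: le_trans.
apply: le_measure; rewrite ?inE//; first exact: measurable_cylinder.
move=> w [_ /= Wy] b; rewrite inE => /eqP -> m.
by rewrite leqn0 => /eqP ->.
Qed.

Context (leS : rel S) (x : S).

Definition walks_at (w : Omega) : nat -> S -> nat -> S :=
  fun k v n => W k v n w.

Lemma measurable_follows st h :
  measurable [set w | follows leS x (walks_at w) st h].
Proof.
have mm := (sigma_algebra_measurable Omega); elim: h st => [|e h IH] st /=.
  exact: (salg_const mm).
apply: (salg_and mm); last exact: IH.
case: (as_walker st) => [[[v y] n]|].
  have := measurable_walk (as_explorer st) v n.+1 e.2; congr measurable.
  apply/seteqP; split => w /=; first by move=> E; exists v, y, n.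
  by move=> [_ [_ [_ [[<- _ <-]]]]].
have := salg_const mm False; congr measurable.
by apply/seteqP; split => // w [v [y [n []]]].
Qed.

(** Ties a state to the cylinder of walks that its past determines: each explorer
    that has left owns one walk, known up to its present step. *)
Definition recorded (st : agg_state) (D : seq (nat * S)) (len : nat * S -> nat)
    (path : nat * S -> nat -> S) : Prop :=
  [/\ uniq D, forall a, a \in D -> (a.1 <= as_explorer st)%N &
      if as_walker st is Some (v, y, n) then
        [/\ (as_explorer st, v) \in D, len (as_explorer st, v) = n &
            path (as_explorer st, v) n = y]
      else True].

Lemma recorded_launch k c s D len path : uniq D ->
  (forall a, a \in D -> (a.1 < k)%N) ->
  exists D' len' path',
    [/\ recorded (AggState k c s (launch leS c)) D' len' path',
        cylinder_weight D' len' path' = cylinder_weight D len path &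
        cylinder D len path `&` proper_starts `<=` cylinder D' len' path'].
Proof.
move=> uD Dk; rewrite /recorded /launch /=; case: next_source => [v|] /=.
  2: by exists D, len, path; split => //; split => // a /Dk /ltnW.
have new_D a : a \in D -> a == (k, v) = false.
  by move=> /Dk; case: eqP => // ->; rewrite ltnn.
exists ((k, v) :: D), (fun a => if a == (k, v) then 0%N else len a),
  (fun a m => if a == (k, v) then v else path a m); split.
- split; last by rewrite mem_head eqxx.
    by rewrite /= uD andbT; apply/negP => /new_D; rewrite eqxx.
  by move=> a; rewrite inE => /predU1P[->//|/Dk /ltnW].
- rewrite /cylinder_weight big_cons !eqxx big_ord0 !mul1r.
  by apply: eq_big_seq => a /new_D ->.
- move=> w [Cw sw] a; rewrite inE => /predU1P[->|aD] m.
    by rewrite eqxx leqn0 => /eqP ->; exact: (sw (k, v)).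
  by rewrite new_D //; exact: Cw.
Qed.

(** Every step of the history reveals one more step of the walk of the current
    explorer, and a new explorer starts a walk not yet used. *)
Lemma follows_le_recorded r st h D len path :
  stopped leS x r st h -> recorded st D len path ->
  (P (cylinder D len path `&` proper_starts `&`
      [set w | follows leS x (walks_at w) st h]) <=
   (cylinder_weight D len path * history_weight h)%:E)%E.
Proof.
have mps := measurable_proper_starts; have mc := measurable_cylinder.
elim: h st D len path => [|[y0 z] h IH] st D len path /=.
  move=> _ [uD _ _]; rewrite /history_weight big_nil mulr1.
  apply: le_trans (cylinder_le len path uD).
  by apply: le_measure; rewrite ?inE//; [apply: measurableI => //;
    [exact: measurableI|exact: (salg_const (sigma_algebra_measurable Omega))]|
    move=> w [[]]].
case: st => k c s o [_ [v [n]]]; rewrite [as_walker _]/= => -> gh.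
move=> [uD Dk [aD len_a path_a]]; rewrite /= in Dk aD len_a path_a.
set st' := agg_step _ _ _ _ in gh *.
set len1 := longer len (k, v); set path1 := extend len path (k, v) z.
have [D' [len' [path' [rec' wE sub']]]] : exists D' len' path',
    [/\ recorded st' D' len' path',
        cylinder_weight D' len' path' = cylinder_weight D len1 path1 &
        cylinder D len1 path1 `&` proper_starts `<=` cylinder D' len' path'].
  rewrite /st' /agg_step; case: eqP => cz; first exact: recorded_launch.
  exists D, len1, path1; split => //; split => //=.
  by split; rewrite /len1 /path1 /longer /extend ?eqxx ?len_a ?addn1 ?eqxx.
have w1E : cylinder_weight D len1 path1 = cylinder_weight D len path * p y0 z.
  by rewrite cylinder_weight_extend // len_a path_a.
rewrite /history_weight big_cons mulrA -w1E -wE.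
apply: le_trans (IH _ _ _ _ gh rec'); apply: le_measure; rewrite ?inE.
- apply: measurableI; first exact: measurableI.
  exact: (measurable_follows (AggState k c s (Some (v, y0, n))) ((y0, z) :: h)).
- by apply: measurableI; [exact: measurableI|exact: measurable_follows].
- move=> w [[Cw sw] [[_ [_ [_ [[<- _ <-] Wz]]]] fh]]; split => //; split => //.
  apply: sub'; split => //; have := cylinder_extend (a0 := (k, v)) Cw.
  by rewrite len_a /= -[W k v n.+1 w]/(walks_at w k v n.+1) Wz /path1.
Qed.

Lemma follows_le gamma0 r h : stopped leS x r (agg_start leS gamma0) h ->
  (P [set w | follows leS x (walks_at w) (agg_start leS gamma0) h] <=
   (history_weight h)%:E)%E.
Proof.
move=> gh; pose F := [set w | follows leS x (walks_at w) (agg_start leS gamma0) h].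
have [D [len [path [rec wE sub]]]] :=
  @recorded_launch 0%N gamma0 [::] [::] (fun=> 0%N) (fun a _ => a.2) isT
    (fun a (H : a \in [::]) => ltac:(by [])).
have mF : measurable F by exact: measurable_follows.
have mps := measurable_proper_starts.
rewrite -[P _](measure_setI_full mF mps proper_starts_full).
have := follows_le_recorded gh rec; rewrite wE /cylinder_weight big_nil mul1r.
apply: le_trans; apply: le_measure; rewrite ?inE.
- exact: measurableI.
- by apply: measurableI => //; apply: measurableI => //; exact: measurable_cylinder.
- by move=> w [Fw sw]; split => //; split => //; apply: sub; split.
Qed.

End history_law.

(** * Spending the moves of a history in another order *)

Section spending.
Context {S : countType}.
Implicit Types (h : seq (S * S)) (v : S).

Definition sources h : seq S := [seq e.1 | e <- h].

Fixpoint dest h v : S :=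
  if h is e :: h' then if e.1 == v then e.2 else dest h' v else v.

Fixpoint spend h v : seq (S * S) :=
  if h is e :: h' then if e.1 == v then h' else e :: spend h' v else [::].

(** The stack of destinations that [h] prescribes at [v]. *)
Definition dests_from v h : seq S := [seq e.2 | e <- h & e.1 == v].

Lemma perm_spend h v : v \in sources h ->
  perm_eq h ((v, dest h v) :: spend h v).
Proof.
elim: h => //= -[u z] h IH; rewrite inE eq_sym /=.
case: eqVneq => [->//|uv] /= /IH ph.
apply: (@perm_trans _ [:: (u, z), (v, dest h v) & spend h v]).
  by rewrite perm_cons.
by have /permPl := perm_catCA [:: (u, z)] [:: (v, dest h v)] (spend h v).
Qed.

Lemma sub_sources_spend h v : {subset sources (spend h v) <= sources h}.
Proof.
elim: h => //= -[u z] h IH t /=; case: eqVneq => _ /=; rewrite !inE.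
  by move=> ->; rewrite orbT.
by move=> /predU1P[->|/IH ->]; rewrite ?eqxx ?orbT.
Qed.

Lemma size_spend h v : v \in sources h -> size h = (size (spend h v)).+1.
Proof. by move=> /perm_spend /perm_size. Qed.

Lemma dests_from_spend h v : v \in sources h ->
  dests_from v h = dest h v :: dests_from v (spend h v).
Proof.
rewrite /dests_from; elim: h => //= -[u z] h IH; rewrite inE eq_sym /=.
by case: eqVneq => [->//|uv] /= /IH; rewrite (negPf uv).
Qed.

Lemma dests_from_spend_neq h u v : u != v ->
  dests_from v (spend h u) = dests_from v h.
Proof.
rewrite /dests_from => uv; elim: h => //= -[t z] h /=.
by case: eqVneq => [->|_] /=; [rewrite (negPf uv)|case: ifP => _ /= ->].
Qed.

Lemma topple_comm (c : S -> int) e f :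
  topple (topple c e) f = topple (topple c f) e.
Proof. by apply/funext => u; rewrite /topple; ring. Qed.

(** A toppling at [v] never lowers another vertex, and it commutes with the
    others: the first move from [v] may be made at once. *)
Lemma legal_spend (c : S -> int) h v : legal c h -> v \in sources h ->
  legal (topple c (v, dest h v)) (spend h v).
Proof.
elim: h c => //= -[u z] h IH c /= [cu lh]; rewrite inE (eq_sym v u).
case: eqVneq => [<-//|uv] /= vh; split.
  by rewrite /topple /= (negPf uv) subr0 -[2]addr0 lerD.
by rewrite topple_comm; exact: IH.
Qed.

End spending.

(** * Paths of activated random walkers *)

Lemma near_leftP {R : realType} (t : R) (Q : R -> Prop) :
  (\forall s \near t^'-, Q s) <->
  exists2 e, e < t & forall s, e < s < t -> Q s.
Proof.
split=> [/nbhs_ballP[e /= e0 H]|[e et H]].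
  exists (t - e); first by rewrite ltrBlDr ltrDl.
  move=> s /andP[es st]; apply: H => //; rewrite /ball /= ger0_norm; lra.
near=> s; apply: H; apply/andP; split; near: s; first exact: nbhs_left_gt.
exact: nbhs_left_lt.
Unshelve. all: by end_near. Qed.

Lemma near_rightP {R : realType} (t : R) (Q : R -> Prop) :
  (\forall s \near t^'+, Q s) <->
  exists2 e, t < e & forall s, t < s < e -> Q s.
Proof.
split=> [/nbhs_ballP[e /= e0 H]|[e et H]].
  exists (t + e); first by rewrite ltrDl.
  move=> s /andP[es st]; apply: H => //; rewrite /ball /= ler0_norm; lra.
near=> s; apply: H; apply/andP; split; near: s; first exact: nbhs_right_gt.
exact: nbhs_right_lt.
Unshelve. all: by end_near. Qed.

Lemma midpoint_between {R : realFieldType} (a b : R) :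
  a < b -> a < (a + b) / 2 < b.
Proof. by move=> ab; rewrite !midf_lt. Qed.

Lemma ex_argmin {R : realType} {A : eqType} (f : A -> R) (Q : A -> Prop)
    (s : seq A) :
  (exists2 a, a \in s & Q a) ->
  exists2 a, Q a & forall b, b \in s -> Q b -> f a <= f b.
Proof.
elim: s => [|x s IH] [a //]; rewrite inE => + Qa.
have [[b bs Qb] _|none] := pselect (exists2 b, b \in s & Q b).
  have [c Qc c_min] := IH (ex_intro2 _ _ b bs Qb).
  have [[Qx xc]|nx] := pselect (Q x /\ f x <= f c).
    exists x => // e; rewrite inE => /predU1P[->//|es Qe].
    exact: le_trans xc (c_min _ es Qe).
  exists c => // e; rewrite inE => /predU1P[->|]; last exact: c_min.
  by move=> Qx; case: leP => // /ltW xc; case: nx.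
move=> /predU1P[ax|as_]; last by case: none; exists a.
exists a => // b; rewrite inE => /predU1P[->|bs Qb]; first by rewrite ax.
by case: none; exists b.
Qed.

Section arw_paths.
Context {R : realType} {S : countType} {p : S -> S -> R} {eta0 : S -> nat}.
Context {lambda : \bar R} {d : measure_display} {Omega : measurableType d}.
Context {P : probability Omega R} (X : arw p eta0 lambda P).

Local Notation T := (arw_jump_ring X).
Local Notation pos := (arw_pos X).
Local Notation act := (arw_active X).
Local Notation F := (arw_filt X).

(** Makes the sequel independent of whether the sleep rate is finite: then the
    jump clocks are a subfamily of all the clocks. *)
Lemma jump_clocks : poisson_clocks P F (fun=> 1) T.
Proof.
move: (arw_clocks X); move: F T (arw_sleep_ring X) => G TT U.
case: (lambda) => [l||] // [T0 Tlt Tinf TF law]; split.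
- by move=> i w; exact: (T0 (inl i)).
- by move=> i n w; exact: (Tlt (inl i)).
- by move=> i w; exact: (Tinf (inl i)).
- by move=> i n t; exact: (TF (inl i)).
move=> s t B D k s0 st Bs uD.
have := law s t B [seq inl i | i <- D] (fun c => if c is inl i then k i else 0%N)
  s0 st Bs.
rewrite map_inj_uniq ?uD => [/(_ isT)|i j [] //].
rewrite big_map; congr (P (_ `&` _) = _); apply/seteqP; split => w Hw.
  by move=> i iD; apply: (Hw (inl i)); rewrite /= map_f.
by move=> c /mapP[i iD ->]; exact: Hw.
Qed.

Lemma asleep_alone i t w : 0 < t -> ~~ act i t w -> alone pos i t w.
Proof.
move=> t0; have [y [b H]] := arw_left_limit X i w t0.
move: (arw_status X) H; move: pos act (arw_sleep_ring X) => q a U.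
case: (lambda) => [l||] st H.
- by case: st => _ /(_ _ _ _ _ _ t0 H) E /E[].
- by move=> /(proj1 (st i t w (ltW t0))).
- by move=> /(proj1 (st i t w (ltW t0))).
Qed.

Lemma ring_gt0 i n w : 0 < T i n w.
Proof.
have [T0 Tlt _ _ _] := jump_clocks.
by elim: n => // n IH; exact: lt_trans IH (Tlt i n w).
Qed.

Lemma ring_lt i m n w : (m < n)%N -> T i m w < T i n w.
Proof.
have [_ Tlt _ _ _] := jump_clocks.
by move=> mn; apply: (@homo_ltn _ (fun n => T i n w) _ lt_trans) mn => k.
Qed.

Lemma ring_le i m n w : (m <= n)%N -> T i m w <= T i n w.
Proof. by rewrite leq_eqVlt => /predU1P[->//|/ring_lt /ltW]. Qed.

Lemma ring_unbounded i w (t : R) : exists n, t < T i n w.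
Proof.
have [_ _ Tinf _ _] := jump_clocks.
have /cvgryPgt/(_ t) := Tinf i w.
by move=> [n _ H]; exists n; apply: H => /=.
Qed.

Lemma beforeP i t w y b : before pos act i t w y b <->
  exists2 e, e < t & forall s, e < s < t -> pos i s w = y /\ act i s w = b.
Proof. exact: near_leftP. Qed.

Lemma before_unique i t w y b y' b' : before pos act i t w y b ->
  before pos act i t w y' b' -> y = y' /\ b = b'.
Proof.
move=> /beforeP[e et H] /beforeP[e' et' H'].
pose s := (Num.max e e' + t) / 2.
have ms : Num.max e e' < s < t.
  by apply: midpoint_between; rewrite gt_max et.
have [? ?] : e < s < t /\ e' < s < t.
  by move: ms; rewrite gt_max => /andP[/andP[-> ->] ->].
by have [//|<- <-] := H s; have [//|<- <-] := H' s.
Qed.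

Definition departs (i : particle eta0) (n : nat) (v : S) (w : Omega) : Prop :=
  before pos act i (T i n w) w v true.

Lemma departs_unique i n v v' w : departs i n v w -> departs i n v' w -> v = v'.
Proof. by move=> dv dv'; case: (before_unique dv dv'). Qed.

(** A particle can only leave [y] by a departure from [y]: the times up to which
    it is known to have stayed form an interval, which is closed by the left
    limits and open to the right. *)
Lemma pos_const i w t0 t1 y : 0 <= t0 -> t0 <= t1 -> pos i t0 w = y ->
  (forall n, t0 < T i n w <= t1 -> ~ departs i n y w) -> pos i t1 w = y.
Proof.
move=> t00 t01 p0 stay.
pose B := [set s | t0 <= s <= t1 /\ forall u, t0 <= u <= s -> pos i u w = y].
have Bt0 : B t0.
  split; first by rewrite lexx.
  by move=> u; rewrite -eq_le => /eqP <-.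
have supB : has_sup B by split; [exists t0|exists t1 => s [/andP[]]].
set s := sup B; have t0s : t0 <= s by apply: ub_le_sup => //; case: supB.
have st1 : s <= t1 by apply: ge_sup; [exists t0|move=> u [/andP[]]].
have below u : t0 <= u -> u < s -> pos i u w = y.
  move=> t0u us; have [|b [_ Bb]] := sup_adherent (eps := s - u) _ supB.
    by rewrite subr_gt0.
  by rewrite opprB addrC subrK => ub; apply: Bb; rewrite t0u ltW.
have at_s : pos i s w = y.
  have [<-//|t0_neq] := eqVneq t0 s.
  have t0s' : t0 < s by rewrite lt_neqAle t0_neq.
  have s0 : 0 < s by exact: le_lt_trans t0s'.
  have [y' [b H]] := arw_left_limit X i w s0.
  have yy' : y' = y.
    have /beforeP[e es He] := H.
    pose m := (Num.max e t0 + s) / 2.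
    have : Num.max e t0 < m < s by apply: midpoint_between; rewrite gt_max es.
    rewrite gt_max => /andP[/andP[em t0m] ms].
    by have [|<- _] := He m; [rewrite em|apply: below => //; exact: ltW].
  subst y'; apply: (arw_stay s0 H) => -[bt [n Tn]].
  apply: (stay n); first by rewrite Tn t0s' st1.
  by rewrite /departs Tn; move: H; rewrite (_ : b = true).
have Bs : B s.
  split; first by rewrite t0s.
  by move=> u /andP[t0u]; rewrite le_eqVlt => /predU1P[->//|]; exact: below.
move: st1; rewrite le_eqVlt => /predU1P[<-//|st1].
have /near_rightP[e se He] := arw_right_continuous X i w (le_trans t00 t0s).
pose m := (s + Num.min e t1) / 2.
have : s < m < Num.min e t1 by apply: midpoint_between; rewrite lt_min se.
rewrite lt_min => /andP[sm /andP[me mt1]].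
suff Bm : B m.
  have : m <= s by apply: ub_le_sup => //; case: supB.
  by rewrite leNgt sm.
split; first by rewrite (le_trans t0s (ltW sm)) ltW.
move=> u /andP[t0u um]; have [us|su] := leP u s.
  by case: Bs => _; apply; rewrite t0u.
by rewrite -at_s; have [|-> _] := He u; rewrite ?su ?(le_lt_trans um).
Qed.

(** Two particles that share a vertex are awake, so the next ring of either one
    is a departure unless the vertex was left before. *)
Lemma shared_vertex_departure i j w t0 v : 0 <= t0 -> i <> j ->
  pos i t0 w = v -> pos j t0 w = v ->
  exists k n, t0 < T k n w /\ departs k n v w.
Proof.
move=> t00 ij pi pj; apply: contrapT => none.
have stay k t : pos k t0 w = v -> t0 <= t -> pos k t w = v.
  move=> pk t0t; apply: pos_const t0t pk _ => // n /andP[t0n _] dn.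
  by apply: none; exists k, n.
have [n t0n] := ring_unbounded i w t0.
have [y [b H]] := arw_left_limit X i w (ring_gt0 i n w).
have /beforeP[e en He] := H.
pose s := (Num.max e t0 + T i n w) / 2.
have : Num.max e t0 < s < T i n w by apply: midpoint_between; rewrite gt_max en.
rewrite gt_max => /andP[/andP[es t0s] sn].
have [|py ab] := He s; first by rewrite es.
have vy : v = y by rewrite -py (stay i) // ltW.
rewrite -{y py}vy in H He *; case: b ab H {He} => ab H.
  by apply: none; exists i, n; split => //; exact: H.
apply: ij; apply/esym; apply: (asleep_alone (t := s) (w := w)).
- exact: le_lt_trans t0s.
- by rewrite ab.
- by rewrite (stay i s pi (ltW t0s)) (stay j s pj (ltW t0s)).
Qed.

(** Only departures strictly before the ring are excluded, so that the event
    belongs to the strict past of the ring; ties are discarded separately, as a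
    null event. *)
Definition next_departure (U : seq S) (t : R) (i : particle eta0) (n : nat)
    (v : S) (w : Omega) : Prop :=
  [/\ v \in U, t < T i n w, departs i n v w &
      forall j m u, u \in U -> t < T j m w -> T j m w < T i n w ->
        ~ departs j m u w].

(** Only finitely many particles reach [U] before a given time, and each of them
    has rung finitely often. *)
Lemma next_departure_exists U t w : 0 <= t ->
  (exists j m u, [/\ u \in U, t < T j m w & departs j m u w]) ->
  exists i n v, next_departure U t i n v w.
Proof.
move=> t0 [j [m [u [uU tm dm]]]]; set t1 := T j m w.
have [ks Hks] : exists ks : seq (particle eta0),
    forall i n v, v \in U -> T i n w <= t1 -> departs i n v w -> i \in ks.
  elim: U {uU} => [|v U [ks IH]]; first by exists [::].
  have /finite_seqP[s Hs] := arw_locally_finite X v t1 w.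
  exists (s ++ ks) => i n v'; rewrite inE mem_cat => /predU1P[->|v'U] nt1 dn;
    apply/orP; [left|right; exact: IH dn].
  suff : [set` s] i by []. rewrite -Hs /=.
  have /beforeP[e en He] := dn.
  have : Num.max e 0 < (Num.max e 0 + T i n w) / 2 < T i n w.
    by apply: midpoint_between; rewrite gt_max en ring_gt0.
  set r := (_ / 2); rewrite gt_max => /andP[/andP[er r0] rn].
  exists r; first by rewrite ltW //= (le_trans (ltW rn)).
  by have [|-> _] := He r; rewrite ?er.
have [N HN] : exists N, forall i, i \in ks -> t1 < T i N w.
  elim: ks {Hks} => [|i ks [N IH]]; first by exists 0%N.
  have [N' HN'] := ring_unbounded i w t1; exists (maxn N N') => k.
  rewrite inE => /predU1P[->|/IH kN].
    by apply: lt_le_trans HN' _; apply: ring_le; exact: leq_maxr.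
  by apply: lt_le_trans kN _; apply: ring_le; exact: leq_maxl.
have cand i n v : v \in U -> T i n w <= t1 -> departs i n v w ->
    (i, n) \in [seq (i, n) | i <- ks, n <- iota 0 N].
  move=> vU nt1 dn; have iks := Hks _ _ _ vU nt1 dn.
  apply/allpairsP; exists (i, n); split => //=; rewrite mem_iota /= ltnNge.
  by apply/negP => /(ring_le i w); rewrite leNgt (le_lt_trans nt1) // HN.
have [|[i n] [v [vU tn nt1 dn]] minn] := @ex_argmin R _ (fun a => T a.1 a.2 w)
    (fun a => exists v, [/\ v \in U, t < T a.1 a.2 w, T a.1 a.2 w <= t1 &
                            departs a.1 a.2 v w])
    [seq (i, n) | i <- ks, n <- iota 0 N].
  by exists (j, m); [exact: cand dm|exists u].
exists i, n, v; split => // k l v' v'U tl ln dl.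
have lt1 : T k l w <= t1 by exact: le_trans (ltW ln) nt1.
have := minn (k, l) (cand _ _ _ v'U lt1 dl).
move=> /(_ (ex_intro _ v' (And4 v'U tl lt1 dl))) /=.
by rewrite leNgt ln.
Qed.

(** A lower bound on the occupation, witnessed by lists of particles. It is
    asked only on [U]: a departure from elsewhere leaves it true. *)
Definition occupied (U : seq S) (c : S -> int) (t : R) (w : Omega) : Prop :=
  forall u, u \in U -> exists s : seq (particle eta0),
    [/\ uniq s, c u <= (size s)%:Z & forall i, i \in s -> pos i t w = u].

(** The first move of a legal history starts at a vertex with two particles,
    which must eventually be left. *)
Lemma legal_next_departure h c t w : 0 <= t -> h <> [::] -> legal c h ->
  occupied (sources h) c t w ->
  exists i n v, next_departure (sources h) t i n v w.
Proof.
case: h => // -[v z] h t0 _ [/= cv _] occ; apply: next_departure_exists => //.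
have [s [us cs ps]] := occ v (mem_head _ _).
move: us cs ps; case: s => [|i [|j s]] /=; [lia|lia|] => us _ ps.
have [|||k [n [tn dn]]] := @shared_vertex_departure i j w t v t0.
- by move=> ij; move: us; rewrite ij inE eqxx.
- by apply: ps; rewrite mem_head.
- by apply: ps; rewrite !inE eqxx orbT.
by exists k, n, v; split => //; exact: mem_head.
Qed.

Definition no_ties (w : Omega) : Prop :=
  forall i n j m, T i n w = T j m w -> i = j.

Lemma no_ties_eq i n j m w : no_ties w -> T i n w = T j m w ->
  i = j /\ n = m.
Proof.
move=> nt E; have ij := nt _ _ _ _ E; subst j; split => //.
by case: (ltngtP n m) => // /(ring_lt i w); rewrite E ltxx.
Qed.

Lemma next_departure_unique U t i n v i' n' v' w : no_ties w ->
  next_departure U t i n v w -> next_departure U t i' n' v' w ->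
  [/\ i = i', n = n' & v = v'].
Proof.
move=> nt [vU tn dn first_n] [vU' tn' dn' first_n'].
have [lt|lt|E] := ltgtP (T i n w) (T i' n' w).
- by case: (first_n' _ _ _ vU tn lt dn).
- by case: (first_n _ _ _ vU' tn' lt dn').
have [ii' nn'] := no_ties_eq nt E; subst i' n'; split => //.
exact: departs_unique dn dn'.
Qed.

(** In the absence of ties a relevant departure acts as one toppling on the lower
    bound: until then the watched vertices only gain particles, and at that time
    no other particle moves. *)
Lemma occupied_departure h c t i n v w : 0 <= t -> no_ties w ->
  next_departure (sources h) t i n v w -> occupied (sources h) c t w ->
  pos i (T i n w) w = dest h v ->
  occupied (sources (spend h v)) (topple c (v, dest h v)) (T i n w) w.
Proof.
move=> t0 nt [vh tn dn first_n] occ pz u uh.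
have {}uh := sub_sources_spend uh.
have [s [us cs ps]] := occ u uh.
have others j : j \in s -> j != i -> pos j (T i n w) w = u.
  move=> js ji; apply: pos_const t0 (ltW tn) (ps _ js) _ => m.
  rewrite le_eqVlt => /andP[tm /predU1P[E|lt]]; last exact: first_n.
  by case: (no_ties_eq nt E) ji => ->; rewrite eqxx.
have i_moved : i \in s -> u = v.
  move=> is_; have /beforeP[e en He] := dn.
  have : Num.max e t < (Num.max e t + T i n w) / 2 < T i n w.
    by apply: midpoint_between; rewrite gt_max en.
  set r := (_ / 2); rewrite gt_max => /andP[/andP[er tr] rn].
  have [|<- _] := He r; first by rewrite er.
  apply/esym; apply: pos_const t0 (ltW tr) (ps _ is_) _ => m /andP[tm mr].
  by apply: first_n => //; exact: le_lt_trans mr rn.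
(* [i] need not belong to [s] when [u = v]: it may have come after time [t]. *)
pose s' : seq (particle eta0) := rem i s.
have size_s' : (size s <= size s' + (u == v))%N.
  rewrite /s'; have [is_|ns] := boolP (i \in s); last by rewrite rem_id // leq_addr.
  by rewrite (i_moved is_) eqxx size_rem // addn1 leqSpred.
have s'P j : j \in s' -> pos j (T i n w) w = u.
  by rewrite mem_rem_uniq // !inE => /andP[ji js]; exact: others.
have us' : uniq s' by exact: rem_uniq.
have ns' : i \notin s' by rewrite mem_rem_uniq // !inE eqxx.
exists (if u == dest h v then i :: s' else s'); split.
- by case: ifP => //=; rewrite ns'.
- rewrite /topple /=; move: cs size_s'.
  by case: (u == dest h v); case: (u == v) => /=; lia.
- move=> j; case: eqP => [ud|_]; last exact: s'P.
  by rewrite inE => /predU1P[->|/s'P//]; rewrite pz ud.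
Qed.

(** The history is spent in the order in which the particles leave its vertices,
    which need not be the order of [h]. At each stage only the vertices that
    still have a move to make are watched. *)
Inductive realized (w : Omega) : seq (S * S) -> R -> Prop :=
| realized_nil t : realized w [::] t
| realized_step h t i n v :
    next_departure (sources h) t i n v w -> pos i (T i n w) w = dest h v ->
    realized w (spend h v) (T i n w) -> realized w h t.

Lemma realizedE h t w : h <> [::] -> realized w h t <->
  exists a : particle eta0 * nat * S,
    [/\ next_departure (sources h) t a.1.1 a.1.2 a.2 w,
        pos a.1.1 (T a.1.1 a.1.2 w) w = dest h a.2 &
        realized w (spend h a.2) (T a.1.1 a.1.2 w)].
Proof.
move=> h0; split=> [H|[[[i n] v] [nd pd rl]]]; last exact: realized_step rl.
by case: H h0 => // {}h {}t i n v nd pd rl _; exists (i, n, v).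
Qed.

Lemma realized_visits x h t w : realized w h t -> exists ts : seq R,
  [/\ uniq ts, size ts = count (fun e => e.2 == x) h &
      forall s, s \in ts -> t < s /\ arw_visit X x s w].
Proof.
elim=> [{}t|{}h {}t i n v [vh tn dn _] pd _ [ts [uts sts vts]]].
  by exists [::].
have /permP/(_ (fun e => e.2 == x)) /= -> := perm_spend vh.
have later s : s \in ts -> t < s /\ arw_visit X x s w.
  by move=> /vts[ns vs]; split => //; exact: lt_trans ns.
case: eqP => [dx|_]; last by exists ts.
exists (T i n w :: ts); split => /=; last 1 first.
- move=> s; rewrite inE => /predU1P[->|/later//]; split => //.
  by exists i, n, v; split => //; rewrite pd dx.
- by rewrite uts andbT; apply/negP => /vts[]; rewrite ltxx.
- by rewrite sts.
Qed.

(** What [realized] says at the single vertex [v]. *)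
Fixpoint departures_to (w : Omega) (v : S) (zs : seq S) (t : R) : Prop :=
  if zs is z :: zs' then
    exists i n, [/\ next_departure [:: v] t i n v w, pos i (T i n w) w = z &
      departures_to w v zs' (T i n w)]
  else True.

Lemma departures_to_later v zs t t' w : t <= t' ->
  (forall i n, t < T i n w <= t' -> ~ departs i n v w) ->
  departures_to w v zs t' -> departures_to w v zs t.
Proof.
case: zs => //= z zs tt' none [i [n [[vv tn dn first_n] pz rest]]].
exists i, n; split => //; split => //; first exact: le_lt_trans tt' tn.
move=> j m u uv tm mn; have [mt'|t'm] := leP (T j m w) t'.
  by move: uv; rewrite inE => /eqP ->; apply: none; rewrite tm.
exact: first_n.
Qed.

Lemma departures_to_unique v g z z' zs zs' t w : no_ties w ->
  departures_to w v (g ++ z :: zs) t -> departures_to w v (g ++ z' :: zs') t ->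
  z = z'.
Proof.
move=> nt; elim: g t => [|y g IH] t /= [i [n [nd pz r]]] [i' [n' [nd' pz' r']]];
  have [ii' nn' _] := next_departure_unique nt nd nd'; subst i' n'.
  by rewrite -pz -pz'.
exact: IH r r'.
Qed.

(** The order in which different vertices are left is lost, but the moves from a
    given vertex are made in the order of [h]. *)
Lemma realized_departures_to h t v w : no_ties w -> realized w h t ->
  departures_to w v (dests_from v h) t.
Proof.
move=> nt; elim=> [//|{}h {}t i n u [uh tn dn first_n] pd _ IH].
have [uv|uv] := eqVneq u v.
  subst u; rewrite dests_from_spend //=; exists i, n; split => //; split => //.
    exact: mem_head.
  by move=> j m u'; rewrite inE => /eqP ->; exact: first_n.
rewrite dests_from_spend_neq // in IH.
have [vh|nvh] := boolP (v \in sources h); last first.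
  suff -> : dests_from v h = [::] by [].
  rewrite /dests_from (eq_in_filter (a2 := pred0)) ?filter_pred0 // => e eh.
  by apply: contraNF nvh => /eqP <-; exact: map_f.
apply: departures_to_later IH; first exact: ltW.
move=> j m; rewrite le_eqVlt => /andP[tm /predU1P[E|mn]]; last exact: first_n.
have [ji mn] := no_ties_eq nt E; subst j m => dv.
by move: uv; rewrite (departs_unique dn dv) eqxx.
Qed.

Lemma realized_diverge h h' t w : no_ties w -> diverge h h' ->
  realized w h t -> realized w h' t -> False.
Proof.
move=> nt [g [v [z [z' [h1 [h2 [zz' -> ->]]]]]]].
move=> /(realized_departures_to v nt) + /(realized_departures_to v nt).
rewrite /dests_from !filter_cat /= eqxx !map_cat /= => H H'.
by move: zz'; rewrite (departures_to_unique nt H H') eqxx.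
Qed.
End arw_paths.

(** * The past of a ring *)

Section pasts.
Context {R : realType} {S : countType} {p : S -> S -> R} {eta0 : S -> nat}.
Context {lambda : \bar R} {d : measure_display} {Omega : measurableType d}.
Context {P : probability Omega R} (X : arw p eta0 lambda P).

Local Notation T := (arw_jump_ring X).
Local Notation pos := (arw_pos X).
Local Notation act := (arw_active X).
Local Notation F := (arw_filt X).
Local Notation strict i n := (strict_past F (T i n)).

Lemma filt_salg t : sigma_algebra setT (F t).
Proof. by case: (arw_filtration X). Qed.

Lemma filt_le s t A : s <= t -> F s A -> F t A.
Proof. by move=> st; case: (arw_filtration X) => _ /(_ _ _ st) + _; apply. Qed.

Lemma ring_le_filt i n s t : 0 <= s -> s <= t -> F t [set w | T i n w <= s].
Proof.
move=> s0 st; apply: filt_le st _.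
by have [_ _ _ + _] := jump_clocks X; apply.
Qed.

Lemma ring_gt_filt i n s t : 0 <= s -> s <= t -> F t [set w | s < T i n w].
Proof.
move=> s0 st; have := salg_not (filt_salg t) (ring_le_filt i n s0 st).
by congr (F t); apply/seteqP; split => w /=; rewrite ltNge => /negP.
Qed.

(** The sigma-algebra F_tau of the events known at [tau], for a stopping time
    [tau]. *)
Definition past (tau : Omega -> R) : set (set Omega) :=
  [set A | forall q, 0 <= q -> F q [set w | A w /\ tau w <= q]].

Definition start_or_ring (o : option (particle eta0 * nat)) (w : Omega) : R :=
  if o is Some (i, n) then T i n w else 0.

Lemma start_or_ring_ge0 o w : 0 <= start_or_ring o w.
Proof. by case: o => [[i n]|] //=; exact/ltW/ring_gt0. Qed.

Lemma start_or_ring_filt o q : 0 <= q -> F q [set w | start_or_ring o w <= q].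
Proof.
move=> q0; case: o => [[i n]|] /=; first exact: ring_le_filt.
exact: (salg_const (filt_salg q)).
Qed.

Lemma past_salg o : sigma_algebra setT (past (start_or_ring o)).
Proof.
split=> [q q0|A HA q q0|A HA q q0].
- have := salg0 (filt_salg q); congr (F q).
  by apply/seteqP; split => // w [].
- have := salg_and (filt_salg q) (start_or_ring_filt o q0)
    (salg_not (filt_salg q) (HA q q0)); congr (F q).
  apply/seteqP; split => w /=; last by move=> [[_ nA] tq]; split => // -[].
  by move=> [tq nA]; split => //; split => // Aw; exact: nA.
- have := salg_exists (filt_salg q) (fun n => HA n q q0); congr (F q).
  apply/seteqP; split => w /=; first by move=> [n [Aw tq]]; split => //; exists n.
  by move=> [[n _ Aw] tq]; exists n.
Qed.

Lemma past_measurable o A : past (start_or_ring o) A -> measurable A.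
Proof.
move=> HA; have mF : forall t B, F t B -> measurable B.
  by case: (arw_filtration X).
have := @salg_exists _ _ (sigma_algebra_measurable Omega) nat
  (fun n => [set w | A w /\ start_or_ring o w <= n%:R])
  (fun n => mF _ _ (HA n%:R (ler0n _ _))).
congr measurable; apply/seteqP; split => w /=; first by move=> [n []].
move=> Aw; exists (Num.bound (start_or_ring o w)); split => //.
exact/ltW/archi_boundP/start_or_ring_ge0.
Qed.

Lemma strict_salg i n : sigma_algebra setT (strict i n).
Proof. exact: smallest_sigma_algebra. Qed.

Lemma strict_filt i n t A : 0 <= t -> F t A ->
  strict i n [set w | A w /\ t < T i n w].
Proof. by move=> t0 FA; apply: sub_gen_smallest; exists t, A. Qed.

(** An event known at time [tau] is known strictly before a later ring, since a
    rational time separates the two. *)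
Lemma strict_of_past o i n A : past (start_or_ring o) A ->
  strict i n [set w | A w /\ start_or_ring o w < T i n w].
Proof.
move=> HA; have sS := strict_salg i n.
pose B (q : rat) := [set w | 0 <= ratr q :> R /\
  ((A w /\ start_or_ring o w <= ratr q) /\ ratr q < T i n w)].
have HB q : strict i n (B q).
  have [q0|nq] := pselect (0 <= ratr q :> R).
    by apply: (salg_and sS); [exact: (salg_const sS)|exact: strict_filt (HA _ q0)].
  by have := salg0 sS; congr (strict i n); apply/seteqP; split => // w [].
have := salg_exists sS HB; congr (strict i n); apply/seteqP; split => w /=.
  by move=> [q [_ [[Aw oq] qT]]]; split => //; exact: le_lt_trans qT.
move=> [Aw /rat_in_itvoo[q]]; rewrite in_itv /= => /andP[oq qT].
exists q; split; last by split => //; split => //; exact: ltW.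
exact: le_trans (start_or_ring_ge0 o w) (ltW oq).
Qed.

Lemma past_of_strict i n A : strict i n A -> past (T i n) A.
Proof.
move: A; apply: smallest_sub; first exact: (past_salg (Some (i, n))).
move=> _ [t [B [t0 FB ->]]] q q0; have sF := filt_salg q.
have [tq|qt] := leP t q; last first.
  have := salg0 sF; congr (F q); apply/seteqP; split => // w [[_ /= tT] Tq].
  by have := lt_trans qt (lt_le_trans tT Tq); rewrite ltxx.
apply: (salg_and sF); last exact: ring_le_filt.
by apply: (salg_and sF); [exact: filt_le FB|exact: ring_gt_filt].
Qed.

(** A left limit is determined by the rational times shortly before the ring,
    because it exists; this leaves countably many conditions on the strict
    past. *)
Lemma before_strict i n y b :
  strict i n [set w | before pos act i (T i n w) w y b].
Proof.
have sS := strict_salg i n.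
pose A (s : R) := [set w | pos i s w = y /\ act i s w = b].
have FA s : 0 <= s -> F s (A s).
  move=> s0; apply: (salg_and (filt_salg s)); first exact: arw_pos_adapted.
  have FA := arw_active_adapted X i s0; rewrite {}/A; case: (b) => //.
  have := salg_not (filt_salg s) FA; congr (F s).
  by apply/seteqP; split => w /= => [/negP/negbTE|->].
pose B (q q' : rat) := [set w | ratr q < ratr q' :> R ->
   ~ (~ A (ratr q') w /\ ratr q' < T i n w)].
have HB (q q' : rat) : 0 <= ratr q :> R -> strict i n (B q q').
  move=> q0; have [qq'|nqq'] := pselect (ratr q < ratr q' :> R); last first.
    have := salg_const sS True; congr (strict i n).
    by apply/seteqP; split => // w _ qq'; case: (nqq' qq').
  apply: (salg_imply sS); first exact: (salg_const sS).
  apply: (salg_not sS); have q'0 := le_trans q0 (ltW qq').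
  by apply: strict_filt => //; apply: (salg_not (filt_salg _)); exact: FA.
pose C (q : rat) := [set w | 0 <= ratr q :> R /\
  ((True /\ ratr q < T i n w) /\ forall q', B q q' w)].
have HC q : strict i n (C q).
  have [q0|nq] := pselect (0 <= ratr q :> R); last first.
    by have := salg0 sS; congr (strict i n); apply/seteqP; split => // w [].
  apply: (salg_and sS); first exact: (salg_const sS).
  apply: (salg_and sS); last by apply: (salg_forall sS) => q'; exact: HB.
  by apply: strict_filt => //; exact: (salg_const (filt_salg _)).
have := salg_exists sS HC; congr (strict i n).
apply/seteqP; split => w /=.
  move=> [q [q0 [[_ qT] HBw]]].
  have [y' [b' H]] := arw_left_limit X i w (ring_gt0 X i n w).
  have /beforeP[e eT He] := H.
  have [|q'] := @rat_in_itvoo R (Num.max e (ratr q)) (T i n w).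
    by rewrite gt_max eT.
  rewrite in_itv /= gt_max => /andP[/andP[eq' qq'] q'T].
  have [|py ab] := He (ratr q'); first by rewrite eq'.
  have [<- <-] : A (ratr q') w.
    by apply: contrapT => nA; exact: (HBw q' qq').
  by rewrite py ab.
move=> /beforeP[e eT He].
have [|q] := @rat_in_itvoo R (Num.max e 0) (T i n w).
  by rewrite gt_max eT ring_gt0.
rewrite in_itv /= gt_max => /andP[/andP[eq q0] qT].
exists q; split; first exact: ltW.
split => // q' qq' [nA q'T]; apply: nA; apply: He.
by rewrite q'T (lt_trans eq).
Qed.

Lemma pos_between_rings i n t w : T i n w <= t -> t < T i n.+1 w ->
  pos i t w = pos i (T i n w) w.
Proof.
move=> nt tn; apply: pos_const (ltW (ring_gt0 X i n w)) nt erefl _ => m.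
move=> /andP[nm mt] _; have [mn|nm'] := leqP m n.
  by have := lt_le_trans nm (ring_le X i w mn); rewrite ltxx.
have := le_lt_trans mt (lt_le_trans tn (ring_le X i w nm')).
by rewrite ltxx.
Qed.

(** The position taken at a ring is kept until the next ring, so it can be read
    at a rational time before that, or at the present time. *)
Lemma pos_at_ring_past i n z : past (T i n) [set w | pos i (T i n w) w = z].
Proof.
move=> q q0; have sF := filt_salg q.
pose B (s : R) := [set w | 0 <= s <= q /\
  ((T i n w <= s /\ s < T i n.+1 w) /\ pos i s w = z)].
have HB s : F q (B s).
  have [/andP[s0 sq]|ns] := pselect (0 <= s <= q); last first.
    by have := salg0 sF; congr (F q); apply/seteqP; split => // w [].
  apply: (salg_and sF); first exact: (salg_const sF).
  apply: (salg_and sF); last by apply: filt_le sq _; exact: arw_pos_adapted.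
  by apply: (salg_and sF); [exact: ring_le_filt|exact: ring_gt_filt].
have := salg_or sF (HB q) (salg_exists sF (fun r : rat => HB (ratr r))).
congr (F q); apply/seteqP; split => w /=.
  suff H s : B s w -> pos i (T i n w) w = z /\ T i n w <= q.
    by case=> [/H//|[r /H]].
  move=> [/andP[_ sq] [[ns sn] <-]].
  by rewrite -(pos_between_rings ns sn) (le_trans ns sq).
move=> [pz nq]; have [qn|nq'] := ltP q (T i n.+1 w).
  by left; rewrite /B /= q0 lexx nq qn (pos_between_rings nq qn).
(* The next ring has already come: the particle is seen at a rational time
   in between. *)
right; have [r] := rat_in_itvoo (ring_lt X i w (ltnSn n)).
rewrite in_itv /= => /andP[nr rn]; exists r.
rewrite /B /= (ltW nr) rn (pos_between_rings (ltW nr) rn).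
by rewrite (le_trans (ltW rn) nq') (le_trans _ (ltW nr)) // ltW // ring_gt0.
Qed.

Lemma next_departure_strict o A U i n v : past (start_or_ring o) A ->
  strict i n [set w | A w /\ next_departure X U (start_or_ring o w) i n v w].
Proof.
move=> HA; have sS := strict_salg i n; have sO := past_salg o.
pose later j m u := [set w | (True /\ start_or_ring o w < T j m w) /\
  departs X j m u w].
have past_later j m u : past (start_or_ring (Some (j, m))) (later j m u).
  apply: past_of_strict; apply: (salg_and (strict_salg j m)).
    by apply: strict_of_past; exact: (salg_const sO).
  exact: before_strict.
pose N := [set w | forall a : particle eta0 * nat * S, a.2 \in U ->
  ~ (later a.1.1 a.1.2 a.2 w /\ T a.1.1 a.1.2 w < T i n w)].
have HN : strict i n N.
  apply: (salg_forall sS) => -[[j m] u]; apply: (salg_imply sS).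
    exact: (salg_const sS).
  apply: (salg_not sS); exact: (strict_of_past (o := Some (j, m))).
have := salg_and sS (salg_const sS (v \in U))
  (salg_and sS (strict_of_past (i := i) (n := n) HA)
     (salg_and sS (@before_strict i n v true) HN)).
congr (strict i n); apply/seteqP; split => w /=.
  move=> [vU [[Aw ti] [di Nw]]]; split => //; split => // j m u uU tm mn dm.
  by apply: (Nw (j, m, u)).
move=> [Aw [vU ti di first_i]]; split => //; split => //; split => // -[[j m] u] /= uU.
by move=> [[[_ tm] dm] mn]; exact: (first_i j m u).
Qed.

Lemma measurable_next_departure o U i n v : measurable
  [set w | next_departure X U (start_or_ring o w) i n v w].
Proof.
have := @next_departure_strict o _ U i n v
  (salg_const (past_salg o) True).
move=> /past_of_strict /(past_measurable (o := Some (i, n))).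
by congr measurable; apply/seteqP; split => w //= [].
Qed.

Lemma measurable_pos_at_ring i n z : measurable [set w | pos i (T i n w) w = z].
Proof. exact: (@past_measurable (Some (i, n)) _ (@pos_at_ring_past i n z)). Qed.

Lemma measurable_departs i n v : measurable [set w | departs X i n v w].
Proof.
apply: (@past_measurable (Some (i, n))); apply: past_of_strict.
exact: before_strict.
Qed.

Lemma measurable_realized h o :
  measurable [set w | realized X w h (start_or_ring o w)].
Proof.
have sM := sigma_algebra_measurable Omega.
have [k] := ubnP (size h); elim: k h o => // k IH h o hk.
have [->|h0] := pselect (h = [::]).
  have := salg_const sM True; congr measurable.
  by apply/seteqP; split => w //= _; exact: realized_nil.
pose A (a : particle eta0 * nat * S) := [set w | a.2 \in sources h /\
  (next_departure X (sources h) (start_or_ring o w) a.1.1 a.1.2 a.2 w /\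
   (pos a.1.1 (T a.1.1 a.1.2 w) w = dest h a.2 /\
    realized X w (spend h a.2) (T a.1.1 a.1.2 w)))].
have mA a : measurable (A a).
  case: a => [[i n] v]; have [ah|nah] := pselect (v \in sources h); last first.
    by have := salg0 sM; congr measurable; apply/seteqP; split => // w [].
  apply: (salg_and sM); first exact: (salg_const sM).
  apply: (salg_and sM); first exact: measurable_next_departure.
  apply: (salg_and sM); first exact: measurable_pos_at_ring.
  by apply: (IH _ (Some (i, n))); move: hk; rewrite (size_spend ah) ltnS.
have := salg_exists sM mA; congr measurable; apply/seteqP; split => w /=.
  by move=> [a [_ [nd [pd rl]]]]; apply/(realizedE X _ _ h0); exists a.
by move=> /(realizedE X _ _ h0)[a [nd pd rl]]; exists a; split => //; case: nd.
Qed.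

Lemma measurable_ring_eq i n j m : measurable [set w | T i n w = T j m w].
Proof.
have sM := sigma_algebra_measurable Omega.
have lt k l k' l' : measurable [set w | T k l w < T k' l' w].
  have := strict_of_past (i := k') (n := l')
      (salg_const (past_salg (Some (k, l))) True).
  move=> /past_of_strict /(past_measurable (o := Some (k', l'))).
  by congr measurable; apply/seteqP; split => w //= [].
have := salg_and sM (salg_not sM (lt i n j m)) (salg_not sM (lt j m i n)).
congr measurable; apply/seteqP; split => w /=; last by move=> ->; rewrite ltxx.
by move=> [/negP + /negP]; rewrite -!leNgt => ji ij; apply/eqP; rewrite eq_le ij.
Qed.

Lemma measurable_no_ties : measurable [set w | no_ties X w].
Proof.
have sM := sigma_algebra_measurable Omega.
do 4! [apply: (salg_forall sM) => ?].
by apply: (salg_imply sM); [exact: measurable_ring_eq|exact: (salg_const sM)].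
Qed.

Lemma measurable_arw_visited r x : measurable (arw_visited X r x).
Proof.
have sM := sigma_algebra_measurable Omega.
pose time (a : particle eta0 * nat * S) w := T a.1.1 a.1.2 w.
pose A l := [set w | r <= (size l)%:Z /\
  (uniq [seq time a w | a <- l] /\ forall a, a \in l ->
    departs X a.1.1 a.1.2 a.2 w /\ pos a.1.1 (time a w) w = x)].
have mA l : measurable (A l).
  apply: (salg_and sM); first exact: (salg_const sM).
  apply: (salg_and sM).
    elim: l => [|a l IH] /=; first exact: (salg_const sM).
    have mN : measurable [set w | forall b, b \in l -> ~ time a w = time b w].
      apply: (salg_seq_all sM) => b _; apply: (salg_not sM).
      exact: measurable_ring_eq.
    have := salg_and sM mN IH; congr measurable.
    apply/seteqP; split => w /= => [[al ul]|/andP[al ul]].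
      apply/andP; split => //; apply/mapP => -[b bl E]; exact: (al b).
    by split => // b bl E; move/mapP: al; apply; exists b.
  apply: (salg_seq_all sM) => a _; apply: (salg_and sM).
    exact: measurable_departs.
  exact: measurable_pos_at_ring.
have := salg_exists sM mA; congr measurable; apply/seteqP; split => w /=.
  move=> [l [rl [ul Hl]]]; exists [seq time a w | a <- l].
  split => //; first by rewrite size_map.
  move=> t /mapP[a /Hl[da pa] ->]; exists a.1.1, a.1.2, a.2; split => //.
move=> [ts [uts rts vts]].
suff [l [lts Hl]] : exists l, [seq time a w | a <- l] = ts /\ forall a,
    a \in l -> departs X a.1.1 a.1.2 a.2 w /\ pos a.1.1 (time a w) w = x.
  by exists l; rewrite /A /= lts -(size_map (time^~ w)) lts.
elim: ts vts {uts rts} => [|t ts IH] vts; first by exists [::].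
have [l [<- Hl]] := IH (fun s sts => vts s (mem_behead (s := t :: ts) sts)).
have [i [n [y [nt dy px]]]] := vts t (mem_head _ _).
exists ((i, n, y) :: l); rewrite /= /time /= nt; split => // a.
rewrite inE => /predU1P[->|/Hl//] /=; rewrite /departs nt; split => //.
Qed.

End pasts.

(** * Distinct clocks never ring together *)

Section ties.
Context {R : realType} {d : measure_display} {Omega : measurableType d}.
Context {P : probability Omega R} {F : R -> set (set Omega)} {J : eqType}.
Context {T : J -> nat -> Omega -> R}.
Hypothesis filtF : filtration F.
Hypothesis clocks : poisson_clocks P F (fun=> 1) T.

Definition quiet (j : J) (s t : R) : set Omega :=
  [set w | forall n, ~ (s < T j n w <= t)].

Lemma clock_measurable j n t : 0 <= t -> measurable [set w | T j n w <= t].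
Proof.
by move=> t0; case: filtF => _ _; apply; case: clocks => _ _ _ TF _; exact: TF.
Qed.

Lemma measurable_quiet j s t : 0 <= s -> s <= t -> measurable (quiet j s t).
Proof.
have sM := sigma_algebra_measurable Omega.
move=> s0 st; apply: (salg_forall sM) => n; apply: (salg_not sM).
have := salg_and sM (salg_not sM (clock_measurable j n s0))
  (clock_measurable j n (le_trans s0 st)).
congr measurable; apply/seteqP; split => w /=.
  by move=> [/negP + Tt]; rewrite -ltNge Tt andbT.
by move=> /andP[sT Tt]; split => //; apply/negP; rewrite -ltNge.
Qed.

Lemma quiet_law (D : seq J) s t : 0 <= s -> s < t -> uniq D ->
  P (\bigcap_(j in [set` D]) quiet j s t) =
  (\prod_(j <- D) expR (- (t - s)))%:E.
Proof.
move=> s0 st uD; case: clocks => _ _ _ _ /(_ s t setT D (fun=> 0%N) s0 st).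
have FT : F s setT.
  case: filtF => /(_ s) sF _ _; have := salg_const sF True.
  by congr (F s); apply/seteqP; split.
move=> /(_ FT uD); rewrite setTI probability_setT mul1e.
have -> : (\bigcap_(j in [set` D])
    [set w | ([set n | s < T j n w <= t] #= `I_0)%card])%classic =
    \bigcap_(j in [set` D]) quiet j s t.
  apply: eq_bigcapr => j _; rewrite II0; apply/seteqP; split => w /=.
    by rewrite card_eq0 => /eqP/seteqP[H _] n; exact: (H n).
  by move=> qw; rewrite card_eq0; apply/eqP/seteqP; split.
move=> ->; congr EFin; apply: eq_bigr => j _.
by rewrite mul1r /poisson_pmf subr_gt0 st expr0 fact0 invr1 !mul1r.
Qed.

(** Inclusion and exclusion from the probabilities that one clock, or both, stay
    quiet. *)
Lemma both_ring_le i j s t : i != j -> 0 <= s -> s < t ->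
  (P (~` quiet i s t `&` ~` quiet j s t) <= ((t - s) ^+ 2)%:E)%E.
Proof.
move=> ij s0 st; set A := quiet i s t; set B := quiet j s t.
set e := expR (- (t - s)).
have mA : measurable A by apply: measurable_quiet => //; exact: ltW.
have mB : measurable B by apply: measurable_quiet => //; exact: ltW.
have one k : P (quiet k s t) = e%:E.
  have := @quiet_law [:: k] s t s0 st isT.
  by rewrite big_seq1 (_ : \bigcap_(_ in _) _ = quiet k s t) //;
    apply/seteqP; split => w Hw; [apply: Hw => /=; exact: mem_head|
    move=> l; rewrite /= inE => /eqP ->].
have two : P (A `&` B) = (e * e)%:E.
  have := @quiet_law [:: i; j] s t s0 st.
  rewrite /= inE ij /= big_cons big_seq1 => <- //; congr (P _).
  apply/seteqP; split => w; first by move=> [Aw Bw] k; rewrite /= !inE =>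
    /orP[/eqP ->|/eqP ->].
  by move=> H; split; apply: H; rewrite /= !inE eqxx ?orbT.
have nA : P (~` A) = (1 - e)%:E by rewrite probability_setC // one.
have mA' := measurableC mA; have mB' := measurableC mB.
have fin C : measurable C -> P C = (fine (P C))%:E.
  by move=> mC; rewrite fineK // fin_num_measure.
have DB : P (B `&` ~` A) = (e - e * e)%:E.
  have : P B = (P (B `&` ~` A) + P (A `&` B))%E.
    by rewrite -setDE setIC; exact: measureDI.
  rewrite one two (fin (B `&` ~` A)) => [|]; last exact: measurableI.
  by rewrite -EFinD => -[]; move: (fine _) => y Ey; congr EFin; lra.
have DA : P (~` A `&` ~` B) = (1 - e - (e - e * e))%:E.
  have : P (~` A) = (P (~` A `&` ~` B) + P (B `&` ~` A))%E.
    by rewrite -setDE [in X in (_ + X)%E]setIC; exact: measureDI.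
  rewrite nA DB (fin (~` A `&` ~` B)) => [|]; last exact: measurableI.
  by rewrite -EFinD => -[]; move: (fine _) => y Ey; congr EFin; lra.
rewrite DA lee_fin.
have e1 : e <= 1 by rewrite -expR0 ler_expR oppr_le0 subr_ge0 ltW.
have := expR_ge1Dx (- (t - s)); rewrite -/e => e_ge.
have -> : 1 - e - (e - e * e) = (1 - e) ^+ 2 by ring.
by rewrite ler_sqr ?nnegrE ?subr_ge0 //; [lra|exact: ltW].
Qed.

(** When the times up to [K] are cut into [N] cells of equal length, two clocks
    ring in a common cell with probability at most [K ^ 2 / N]. *)
Lemma tie_null i j n m : i != j -> measurable [set w | T i n w = T j m w] ->
  P [set w | T i n w = T j m w] = 0%E.
Proof.
move=> ij mE; have sM := sigma_algebra_measurable Omega.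
have T0 k l w : 0 < T k l w.
  case: clocks => T0 Tlt _ _ _.
  by elim: l => [|l IH]; [exact: T0|exact: lt_trans IH (Tlt _ _ _)].
pose E (K : nat) := [set w | T i n w = T j m w /\ T i n w <= K%:R].
have mEK K : measurable (E K).
  by apply: (salg_and sM) => //; apply: clock_measurable; exact: ler0n.
have -> : [set w | T i n w = T j m w] = [set w | exists K, E K w].
  apply/seteqP; split => w /= => [Ew|[K []//]].
  exists (Num.bound (T i n w)); split => //.
  by apply/ltW/archi_boundP/ltW.
apply: null_exists => // K; apply/eqP; rewrite eq_le measure_ge0 andbT.
apply/lee_addgt0Pr => eps eps0; rewrite add0e.
(* [N] cells of length [h] give [N * h ^ 2 = K ^ 2 / N <= eps]. *)
have [N NK] : exists N : nat, K%:R ^+ 2 / eps < N.+1%:R :> R.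
  exists (Num.bound (K%:R ^+ 2 / eps : R)).
  apply: (@lt_trans _ _ (Num.bound (K%:R ^+ 2 / eps : R))%:R).
    by apply: archi_boundP; rewrite divr_ge0 ?sqr_ge0 // ltW.
  by rewrite ltr_nat.
pose h : R := K%:R / N.+1%:R; pose cut (k : nat) : R := k%:R * h.
pose G k := ~` quiet i (cut k) (cut k.+1) `&` ~` quiet j (cut k) (cut k.+1).
have h0 : 0 <= h by rewrite divr_ge0.
have cut0 k : 0 <= cut k by rewrite mulr_ge0.
have cutS k : cut k.+1 - cut k = h by rewrite /cut -mulrBl -natrB // subSnn mul1r.
have mG k : measurable (G k).
  by apply: measurableI; apply: measurableC; apply: measurable_quiet => //;
    rewrite -subr_ge0 cutS.
have EG : E K `<=` \big[setU/set0]_(k < N.+1) G k.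
  move=> w [Eij TK]; rewrite -bigcup_mkord.
  have Kh : K%:R = cut N.+1 by rewrite /cut /h mulrC divfK // pnatr_eq0.
  have [k kN [ck Tk]] : exists2 k, (k < N.+1)%N & cut k < T i n w /\ T i n w <= cut k.+1.
    move: TK; rewrite Kh; elim: N.+1 => [|l IH] Tl.
      by move: (T0 i n w); rewrite ltNge (le_trans Tl) // /cut mul0r.
    have [/IH[k kl Hk]|lT] := leP (T i n w) (cut l).
      by exists k => //; exact: ltnW.
    by exists l.
  exists k => //; split => /=.
    by move=> /(_ n); apply; rewrite ck Tk.
  by move=> /(_ m); apply; rewrite -Eij ck Tk.
apply: (@le_trans _ _ (P (\big[setU/set0]_(k < N.+1) G k))).
  by apply: le_measure; rewrite ?inE //; exact: bigsetU_measurable.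
apply: (le_trans (Boole_inequality _ _)) => //.
apply: (@le_trans _ _ (\sum_(k < N.+1) (h ^+ 2)%:E)%E).
  apply: lee_sum => k _; rewrite -(cutS k).
  have [h00|hpos] := eqVneq h 0; last first.
    apply: both_ring_le => //; rewrite -subr_gt0 cutS.
    by rewrite lt_neqAle eq_sym hpos.
  rewrite (_ : G k = set0) ?measure0 ?lee_fin ?sqr_ge0 //.
  apply/seteqP; split => // w [+ _]; apply => l /=.
  by rewrite /cut h00 !mulr0; case: ltgtP.
rewrite sumEFin lee_fin sumr_const card_ord -mulr_natr.
rewrite /h expr_div_n -mulrA -[X in _ * X]mulrC expr2 invfM.
rewrite [X in _ * X](_ : _ = N.+1%:R^-1); last by rewrite mulrA mulfV ?mul1r // pnatr_eq0.
rewrite ler_pdivrMr ?ltr0n //; move: NK.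
by rewrite ltr_pdivrMr // => /ltW; rewrite mulrC.
Qed.

End ties.

(** * Realizing a legal history *)

Section realization.
Context {R : realType} {S : countType} {p : S -> S -> R} {eta0 : S -> nat}.
Context {lambda : \bar R} {d : measure_display} {Omega : measurableType d}.
Context {P : probability Omega R} (X : arw p eta0 lambda P).
Hypothesis stoch_p : stochastic p.

Local Notation T := (arw_jump_ring X).
Local Notation pos := (arw_pos X).
Local Notation F := (arw_filt X).

Lemma no_ties_full : P (~` [set w | no_ties X w]) = 0%E.
Proof.
pose A (a : particle eta0 * nat * (particle eta0 * nat)) :=
  [set w | a.1.1 <> a.2.1 /\ T a.1.1 a.1.2 w = T a.2.1 a.2.2 w].
have sM := sigma_algebra_measurable Omega.
have mA a : measurable (A a).
  apply: (salg_and sM); [exact: (salg_const sM)|exact: measurable_ring_eq].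
rewrite (_ : ~` _ = [set w | exists a, A a w]); last first.
  apply/seteqP; split => w /=.
    move=> nt; apply: contrapT => none; apply: nt => i n j m E.
    by apply: contrapT => ij; apply: none; exists ((i, n), (j, m)).
  by move=> [[[i n] [j m]] [/= ij E]] /(_ _ _ _ _ E).
apply: null_exists => // -[[i n] [j m]].
have [->|ij] := eqVneq i j.
  by rewrite (_ : A _ = set0) ?measure0 //; apply/seteqP; split => // w [].
apply/eqP; rewrite eq_le measure_ge0 andbT.
have /= mE := measurable_ring_eq X i n j m.
rewrite -(tie_null (arw_filtration X) (jump_clocks X) ij mE).
by apply: le_measure; rewrite ?inE //; move=> w [].
Qed.

Lemma history_weight_spend h v : v \in sources h ->
  history_weight (p := p) h =
  p v (dest h v) * history_weight (p := p) (spend h v).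
Proof.
by move=> /perm_spend vh; rewrite /history_weight (perm_big _ vh) big_cons.
Qed.

(** While a legal history is not realized, the next departure from one of its
    vertices always comes, and it goes where the history prescribes with the
    probability [p] independently of the past. Spending the moves in the order
    of these departures multiplies the same factors as the history does. *)
Lemma realized_ge h o A : past X (start_or_ring X o) A ->
  (forall w, A w -> no_ties X w -> exists c,
     legal c h /\ occupied X (sources h) c (start_or_ring X o w) w) ->
  ((history_weight (p := p) h)%:E * P A <=
   P [set w | A w /\ realized X w h (start_or_ring X o w)])%E.
Proof.
have [k] := ubnP (size h); elim: k h o A => // k IH h o A hk pastA occA.
have sM := sigma_algebra_measurable Omega.
have mA := past_measurable pastA.
have mreal h' o' := measurable_realized X h' o'.
have mNT := measurable_no_ties X.
have [h0|h0] := pselect (h = [::]).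
  rewrite h0 /history_weight big_nil mul1e; apply: le_measure; rewrite ?inE //.
    by apply: (salg_and sM) => //; exact: mreal.
  by move=> w Aw; split => //; exact: realized_nil.
(* [E a]: the next relevant departure is [a]. [Z a]: it also obeys [h]. [C a]:
   moreover the rest of [h] is realized; these events are disjoint. *)
pose E (a : particle eta0 * nat * S) := [set w | A w /\
  next_departure X (sources h) (start_or_ring X o w) a.1.1 a.1.2 a.2 w].
pose Z a := [set w | E a w /\ pos a.1.1 (T a.1.1 a.1.2 w) w = dest h a.2].
pose C a := [set w | (Z a w /\ realized X w (spend h a.2) (T a.1.1 a.1.2 w)) /\
  no_ties X w].
have mE a : measurable (E a) by apply: (salg_and sM) => //; exact: measurable_next_departure.
have mZ a : measurable (Z a) by apply: (salg_and sM) => //; exact: measurable_pos_at_ring.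
have mC a : measurable (C a).
  case: a => [[i n] v]; apply: (salg_and sM) => //; apply: (salg_and sM) => //.
  exact: (mreal _ (Some (i, n))).
apply: (@le_trans _ _ (\esum_(a in [set: particle eta0 * nat * S])
    ((history_weight (p := p) h)%:E * P (E a))%E)%E).
  rewrite esumZl ?history_weight_ge0 //.
  apply: lee_wpmul2l; first by rewrite lee_fin history_weight_ge0.
  rewrite -(measure_setI_full mA mNT no_ties_full).
  apply: le_measure_esum => //; first exact: measurableI.
  move=> w [Aw nt]; have [c [lc oc]] := occA w Aw nt.
  have [i [n [v nd]]] := legal_next_departure (start_or_ring_ge0 X o w) h0 lc oc.
  by exists (i, n, v).
apply: (@le_trans _ _ (\esum_(a in [set: particle eta0 * nat * S]) P (C a))%E).
  apply: le_esum => -[[i n] v] _.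
  have [vh|nvh] := boolP (v \in sources h); last first.
    rewrite (_ : E _ = set0) ?measure0 ?mule0 //.
    by apply/seteqP; split => // w [_ []]; rewrite (negPf nvh).
  have strictE : strict_past F (T i n) (E (i, n, v)).
    exact: next_departure_strict.
  have -> : P (C (i, n, v)) = P [set w | Z (i, n, v) w /\
      realized X w (spend h v) (start_or_ring X (Some (i, n)) w)].
    apply: (@measure_setI_full _ _ _ P [set w | Z (i, n, v) w /\
      realized X w (spend h v) (start_or_ring X (Some (i, n)) w)]) => //.
      by apply: (salg_and sM) => //; exact: mreal.
    exact: no_ties_full.
  apply: (@le_trans _ _
      ((history_weight (p := p) (spend h v))%:E * P (Z (i, n, v)))%E).
    rewrite (_ : P (Z _) = (P (E (i, n, v)) * (p v (dest h v))%:E)%E); last first.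
      by apply: (arw_jump (dest h v) strictE) => w [_ []].
    rewrite (history_weight_spend vh) EFinM -muleA [X in (_ <= X)%E]muleC.
    by rewrite -muleA [X in (_ <= X)%E]muleC -muleA.
  apply: IH; first by move: hk; rewrite (size_spend vh) ltnS.
    apply: (salg_and (past_salg X (Some (i, n)))); first exact: past_of_strict.
    exact: pos_at_ring_past.
  move=> w [[Aw nd] pd] nt; have [c [lc oc]] := occA w Aw nt.
  exists (topple c (v, dest h v)); split; first exact: legal_spend.
  by apply: occupied_departure nd oc pd => //; exact: start_or_ring_ge0.
apply: esum_le_measure => //; first by apply: (salg_and sM) => //; exact: mreal.
- move=> a b _ _ [w [[[[[_ nda] _] _] nt] [[[[_ ndb] _] _] _]]].
  have [] := next_departure_unique nt nda ndb.
  by case: a b {nda ndb} => [[i n] v] [[j m] u] /= -> -> ->.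
- move=> w [a _ [[[[Aw nd] pd] rl] _]]; split => //.
  by apply/(realizedE X _ _ h0); exists a.
Qed.

Lemma occupied_start (gamma0 : S -> nat) U w :
  (forall x, (gamma0 x <= eta0 x)%N) ->
  occupied X U (fun u => (gamma0 u)%:Z) 0 w.
Proof.
move=> le_ge u _.
exists [seq (Tagged (fun x => 'I_(eta0 x)) k : particle eta0) | k <- enum 'I_(eta0 u)].
split; last by move=> i /mapP[k _ ->]; rewrite arw_pos_init.
  rewrite map_inj_uniq ?enum_uniq // => k l /eqP.
  by rewrite -tag_eqE /tag_eq eqxx tagged_asE => /eqP.
by rewrite size_map size_enum_ord lez_nat.
Qed.

Lemma legal_history_le gamma0 h : (forall x, (gamma0 x <= eta0 x)%N) ->
  legal (fun u => (gamma0 u)%:Z) h ->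
  ((history_weight (p := p) h)%:E <= P [set w | realized X w h 0%R])%E.
Proof.
move=> le_ge lh.
have := @realized_ge h None _ (salg_const (past_salg X None) True).
rewrite (_ : [set _ | True] = setT); last by apply/seteqP; split.
rewrite probability_setT mule1 => H; apply: le_trans (H _) _.
  move=> w _ _; exists (fun u => (gamma0 u)%:Z); split => //.
  exact: occupied_start.
rewrite le_eqVlt; apply/orP; left; apply/eqP; congr (P _).
by apply/seteqP; split => w //= [].
Qed.

End realization.

(** * Comparison of the two processes *)

Section comparison.
Context {R : realType} {S : countType} {p : S -> S -> R} {eta0 : S -> nat}.
Context {lambda : \bar R} {d : measure_display} {Omega : measurableType d}.
Context {P : probability Omega R} (X : arw p eta0 lambda P).

Lemma stopped_realized_visited (leS : rel S) (gamma0 : S -> nat) r x h w :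
  stopped leS x r (agg_start leS gamma0) h -> realized X w h 0 ->
  arw_visited X r x w.
Proof.
move=> sh /(realized_visits x)[ts [uts sts vts]]; exists ts; split => //.
  by rewrite sts; exact: count_stopped sh.
by move=> t /vts[].
Qed.

End comparison.

Unset Implicit Arguments.

Theorem lemma2p1 (R : realType) (S : countType) (p : S -> S -> R)
    (eta0 gamma0 : S -> nat) (lambda : \bar R) (leS : rel S)
    (dA : measure_display) (OmegaA : measurableType dA)
    (PA : probability OmegaA R) (X : arw p eta0 lambda PA)
    (dM : measure_display) (OmegaM : measurableType dM)
    (PM : probability OmegaM R) (W : explorer_walks p PM) :
  stochastic p ->
  (0 < lambda)%E ->
  total_order leS ->
  (\esum_(x in [set: S]) ((gamma0 x)%:R : R)%:E < +oo)%E ->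
  (forall x, (gamma0 x <= eta0 x)%N) ->
  forall (r : int) (x : S),
    (PM (msia_visited leS gamma0 W r x) <= PA (arw_visited X r x))%E.
Proof.
move=> stoch_p _ tS _ le_ge r x.
pose start := agg_start leS gamma0.
have sM := sigma_algebra_measurable OmegaM.
have sA := sigma_algebra_measurable OmegaA.
pose M h := [set w | stopped leS x r start h /\
  follows leS x (walks_at W w) start h].
pose A h := [set w | stopped leS x r start h /\
  (realized X w h 0 /\ no_ties X w)].
have mM h : measurable (M h).
  apply: (salg_and sM); first exact: (salg_const sM).
  exact: measurable_follows.
have mreal h : measurable [set w | realized X w h 0].
  exact: (measurable_realized X h None).
have mA h : measurable (A h).
  apply: (salg_and sA); first exact: (salg_const sA).
  by apply: (salg_and sA); [exact: mreal|exact: (measurable_no_ties X)].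
have visitedE : msia_visited leS gamma0 W r x = [set w | exists h, M h w].
  by apply/seteqP; split => w; move/(msia_visitedP x (walks_at W w) gamma0 r tS).
apply: (@le_trans _ _ (\esum_(h in [set: seq (S * S)]) PM (M h))%E).
  rewrite visitedE; apply: le_measure_esum => //; first exact: (salg_exists sM).
  by move=> w [h Mh]; exists h.
apply: (@le_trans _ _ (\esum_(h in [set: seq (S * S)]) PA (A h))%E).
  apply: le_esum => h _.
  have [sh|nsh] := pselect (stopped leS x r start h); last first.
    by rewrite (_ : M h = set0) ?measure0 //; apply/seteqP; split => // w [].
  have -> : M h = [set w | follows leS x (walks_at W w) start h].
    by apply/seteqP; split => w //= [].
  apply: (le_trans (follows_le W stoch_p sh)).
  have -> : A h = [set w | realized X w h 0] `&` [set w | no_ties X w].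
    by apply/seteqP; split => w //= [].
  rewrite measure_setI_full //; [|exact: (measurable_no_ties X)|exact: (no_ties_full X)].
  apply: (legal_history_le X stoch_p le_ge).
  have -> : (fun u => (gamma0 u)%:Z) = agg_config start.
    by apply/funext => u; rewrite agg_config_launch.
  by apply: legal_stopped sh; exact: agg_wf_launch.
apply: esum_le_measure => //; first exact: measurable_arw_visited.
  move=> h h' _ _ [w [[sh [rh nt]] [sh' [rh' _]]]].
  apply: contrapT => hh'.
  exact: (realized_diverge nt (stopped_diverge sh sh' hh') rh rh').
by move=> w [h _ [sh [rh _]]]; exact: stopped_realized_visited sh rh.
Qed.
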